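(* Let $\Lambda,\delta>0$, $T=L(\Lambda+1)\delta$ with $L\in\mathbb N$, and $0<s<1$. The minimizers of $\mathcal F^T_s$ in $\mathscr A^{T,\Lambda,\delta}$ are exactly the functions $\bar u(\cdot-x_0)+y_0$ with $x_0,y_0\in\mathbb R$.
   Context: The admissible class $\mathscr A^{T,\Lambda,\delta}$ is the set of continuous, $T$-periodic, piecewise affine functions $u:\mathbb R\to\mathbb R$ with $u'\in\{1,-\Lambda\}$ a.e., such that $(u')^{-1}(\{-\Lambda\})=\bigcup_{k\in\mathbb N}I^k$ for some intervals $I^k$ with $|I^k|=\delta$ for all $k$ and $\#(I^i\cap I^j)\le1$ for all $i\ne j$. For $0<s<1$, $$\mathcal F^T_s(u):=\frac1{2T}\int_0^T dx\int_{\mathbb R}\frac{|u(x)-u(y)|^2}{|x-y|^{1+2s}}\,dy.$$ $\bar u$ is the $(\Lambda+1)\delta$-periodic function defined on $(-\delta,\Lambda\delta]$ by $\bar u(x)=-\Lambda x$ for $-\delta<x<0$ and $\bar u(x)=x$ for $0\le x\le\Lambda\delta$ (it belongs to $\mathscr A^{T,\Lambda,\delta}$). *)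

(* Defs.v *)
From HB Require Import structures.
From mathcomp Require Import all_boot all_order all_algebra.
From mathcomp Require Import all_classical all_reals all_analysis.
Set Implicit Arguments. Unset Strict Implicit. Unset Printing Implicit Defensive.
Import Order.TTheory GRing.Theory Num.Theory.
Import numFieldNormedType.Exports.
Local Open Scope classical_set_scope.
Local Open Scope ring_scope.

Section Defs.
Variable R : realType.
Local Notation mu := (@lebesgue_measure R).

Definition piecewise_affine (u : R -> R) : Prop :=
  exists B : set R,
    (forall a b : R, finite_set (B `&` [set` `[a, b]])) /\
    (forall x, ~ B x -> exists2 e : R, 0 < e &
       exists m c : R, forall y, `|y - x| < e -> u y = m * y + c).

Definition admissible (T Lambda delta : R) (u : R -> R) : Prop :=
  [/\ continuous u,
      (forall x, u (x + T) = u x),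
      piecewise_affine u,
      {ae mu, forall x : R, is_derive x (1:R) u (1:R) \/ is_derive x (1:R) u (- Lambda)} &
      exists a : nat -> R,
        (forall i j : nat, i <> j -> forall x y : R,
            (x \in `[a i, a i + delta]) -> (x \in `[a j, a j + delta]) ->
            (y \in `[a i, a i + delta]) -> (y \in `[a j, a j + delta]) -> x = y) /\
        {ae mu, forall x : R, is_derive x (1:R) u (- Lambda) <->
                          exists k : nat, (x \in `[a k, a k + delta])}].

Definition F (T s : R) (u : R -> R) : \bar R :=
  ((2 * T)^-1)%:E *
  (\int[mu]_(x in `[0%R, T]%classic)
     \int[mu]_(y in [set: R])
        ((u x - u y) ^+ 2 / (`|x - y| `^ (1 + 2 * s)))%:E)%E.

Definition is_minimizer (T Lambda delta s : R) (u : R -> R) : Prop :=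
  admissible T Lambda delta u /\
  forall v, admissible T Lambda delta v -> (F T s u <= F T s v)%E.

(* ubar: (Lambda+1)delta-periodic, = -Lambda x on (-delta,0), = x on [0, Lambda delta] *)
Definition ubar (Lambda delta : R) (x : R) : R :=
  let P := (Lambda + 1) * delta in
  let z := x - (Num.ceil ((x - Lambda * delta) / P))%:~R * P in
  if z < 0 then - Lambda * z else z.

End Defs.

(* Main.v *)
(* For a displacement h let S_u(h) be the integral over one period of (u(x+h) - u(x))^2; by
   Tonelli the energy is an average of S_u(h) against the weight |h|^(-1-2s).  It suffices to show
   that, for every single h, S_u(h) is least when the descending intervals I_k = [a_k, a_k + delta]
   are equidistant.  Integrating by parts twice turns S_u(h) into a constant plus a sum over pairs
   of intervals of q(a_k - a_j + t), 0 <= t <= delta, where q is the second difference of step h of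
   the antiderivative of the ramp min(max(x, 0), delta).  As the intervals do not overlap, only the
   values of q on [delta, oo) and on (-oo, 0] occur for k <> j, and q is convex on each of these
   two half-lines.  In the tangent inequality at the equidistant positions the linear terms cancel
   by periodicity.
   For uniqueness, a minimizer has S_u = S_ubar almost everywhere because the minimal energy is
   finite, hence everywhere by continuity.  At h = P := (Lambda + 1) delta this gives S_u(P) = 0,
   so u is P-periodic and therefore has exactly one descending interval per period. *)
Require Import Defs.
From HB Require Import structures.
From mathcomp Require Import all_boot all_order all_algebra.
From mathcomp Require Import all_classical all_reals all_analysis.
From mathcomp Require Import measurable_realfun.
From mathcomp Require Import zify ring lra.
Set Implicit Arguments. Unset Strict Implicit. Unset Printing Implicit Defensive.
Import Order.TTheory GRing.Theory Num.Theory.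
Import numFieldNormedType.Exports.
Local Open Scope classical_set_scope.
Local Open Scope ring_scope.

(** * Calculus on the real line *)

Section Calculus.
Context {R : realType}.
Implicit Types (f g F : R -> R) (a b x y : R).

Lemma is_derive_continuous f g :
  (forall x, is_derive x (1 : R) f (g x)) -> continuous f.
Proof.
move=> H x; apply: differentiable_continuous; apply/derivable1_diffP.
by have [] := H x.
Qed.

Lemma derive0_cst_segment f a b : a <= b -> {within `[a, b], continuous f} ->
  (forall x, a < x < b -> is_derive x (1 : R) f 0) -> f b = f a.
Proof.
move=> ab cf df.
have d x : x \in `]a, b[ -> is_derive x (1 : R) f 0 by rewrite in_itv/= => /df.
have [c _] := MVT_segment ab d cf.
by rewrite mul0r => /eqP; rewrite subr_eq0 => /eqP.
Qed.

Lemma is_derive_translate f g c :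
  (forall x, is_derive x (1 : R) f (g x)) ->
  forall x, is_derive x (1 : R) (fun y => f (y + c)) (g (x + c)).
Proof.
move=> H x; rewrite -[g _]mulr1.
apply: (@is_derive1_comp R f (fun y => y + c) x (g (x + c)) 1 (H _)).
by rewrite -[X in is_derive _ _ _ X]addr0; apply: is_deriveD.
Qed.

(** Mean value theorem. Monotonicity of the derivative is asked only between [x] and [y], because
    the function to which this is applied is convex on two half-lines but not on the whole line. *)
Lemma tangent_le f g x y :
  (forall z, is_derive z (1 : R) f (g z)) ->
  (forall z, x <= z -> z <= y -> g x <= g z) ->
  (forall z, y <= z -> z <= x -> g z <= g x) ->
  f x + g x * (y - x) <= f y.
Proof.
move=> df mono1 mono2.
have cf (i : interval R) : {within [set` i], continuous f}.
  exact: continuous_subspaceT (is_derive_continuous df).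
have [xy|yx] := leP x y.
  have [c] := MVT_segment xy (fun z _ => df z) (cf _).
  rewrite in_itv/= => /andP[xc cy] E.
  have := mono1 _ xc cy; nra.
have [c] := MVT_segment (ltW yx) (fun z _ => df z) (cf _).
rewrite in_itv/= => /andP[yc cx] E.
have := mono2 _ yc cx; nra.
Qed.

(** Integration from a base point [c] gives a primitive only to the right of [c]. Normalised to
    vanish at 0, the primitives for different negative base points agree, so the base point may vary
    with the argument. *)
Lemma antiderivative f : continuous f ->
  exists F, forall x, is_derive x (1 : R) F (f x).
Proof.
move=> cf.
pose G c x := \int[lebesgue_measure]_(t in [set` `[c, x]]) f t.
have dG c x : c < x -> is_derive x (1 : R) (G c) (f x).
  move=> cx; have x1 : x < x + 1 by rewrite ltrDl.
  have [|d <-] := @continuous_FTC1_closed R f c x (x + 1) x1 _ cx (cf x).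
    apply: continuous_compact_integrable; first exact: segment_compact.
    exact: continuous_subspaceT.
  by rewrite derive1E; apply/derivableP.
have GE c d x : c < d -> d < 0 -> d < x -> G c x - G c 0 = G d x - G d 0.
  move=> cd d0 dx; pose H y := G c y - G d y.
  have dH y : d < y -> is_derive y (1 : R) H 0.
    move=> dy; rewrite -(subrr (f y)); apply: is_deriveB; apply: dG => //.
    exact: lt_trans dy.
  suff : H x = H 0 by rewrite /H; lra.
  have cst y z : d < y -> y <= z -> H z = H y.
    move=> dy yz; apply: derive0_cst_segment => //.
      apply: derivable_within_continuous => t; rewrite in_itv/= => /andP[yt _].
      by have [] := dH t (lt_le_trans dy yt).
    by move=> t /andP[yt _]; apply: dH; exact: lt_trans yt.
  by have [x0|/ltW x0] := leP x 0; [rewrite -(cst x 0)|rewrite (cst 0 x)].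
exists (fun x => G (- `|x| - 1) x - G (- `|x| - 1) 0) => x.
(* This base point lies below the one attached to any [y] within distance 1 of [x], so [GE] applies
   to all of them at once. *)
pose c := - `|x| - 2.
have cx : c < x by rewrite /c; have := ler_norm (- x); rewrite normrN; lra.
have : is_derive x (1 : R) (fun y => G c y - G c 0) (f x).
  by rewrite -[f x]subr0; apply: is_deriveB; exact: dG.
apply: near_eq_is_derive.
near=> y.
have yx : `|y - x| < 1 by rewrite distrC; near: y; exact: (nbhsx_ballx x 1 ltr01).
apply: GE; rewrite /c.
- have := ler_normD (y - x) x; rewrite subrK; lra.
- have := normr_ge0 y; lra.
- have := ler_norm (- y); rewrite normrN; lra.
Unshelve. all: by end_near. Qed.


Lemma is_derive_affine f a b p x : a < x < b ->
  (forall y, a <= y <= b -> f y = f a + p * (y - a)) -> is_derive x (1 : R) f p.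
Proof.
move=> /andP[ax xb] fE.
have : is_derive x (1 : R) (fun y => f a + p * (y - a)) p.
  have := is_deriveD (is_derive_cst (f a) x 1)
    (is_deriveZ p (is_deriveB (is_derive_id x 1) (is_derive_cst a x 1))).
  by move=> /is_derive_eq; apply; rewrite add0r subr0 /GRing.scale/= mulr1.
apply: near_eq_is_derive.
near=> y; apply/esym/fE.
suff : y \in `]a, b[ by rewrite in_itv/= => /andP[/ltW -> /ltW ->].
by near: y; apply: near_in_itvoo; rewrite in_itv/= ax.
Unshelve. all: by end_near. Qed.

Lemma is_derive_sum_fun n (f g : nat -> R -> R) x :
  (forall i, is_derive x (1 : R) (f i) (g i x)) ->
  is_derive x (1 : R) (fun y => \sum_(i < n) f i y) (\sum_(i < n) g i x).
Proof.
move=> fg; elim: n => [|n IH].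
  under eq_fun do rewrite big_ord0.
  by rewrite big_ord0; exact: is_derive_cst.
under eq_fun do rewrite big_ord_recr/=.
by rewrite big_ord_recr/=; exact: is_deriveD.
Qed.

Lemma derive_periodic f g T : (forall x, is_derive x (1 : R) f (g x)) ->
  (forall x, g (x + T) = g x) -> forall x, f (x + T) = f x + (f T - f 0).
Proof.
move=> fg gT x; pose k y := f (y + T) - f y.
have dk y : is_derive y (1 : R) k 0.
  rewrite -(subrr (g y)) -{1}gT; apply: is_deriveB.
  exact: (is_derive_translate T fg).
have := is_derive_0_is_cst x 0 dk; rewrite /k add0r; lra.
Qed.

Lemma sum_periodic_shift (d : nat -> R) L e :
  (forall k, d (k + L)%N = d k) -> \sum_(k < L) d (e + k)%N = \sum_(k < L) d k.
Proof.
move=> dL; elim: e => [|e <-]; first by apply: eq_bigr.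
have := @big_ord_recl R 0 +%R L (fun k => d (e + k)%N).
rewrite big_ord_recr/= dL addn0 addrC => /addrI ->.
by apply: eq_bigr => i _; rewrite addSnnS.
Qed.

(** Once a sum is cut to the band of indices at distance at most [M] from [k] and indexed by the
    offset [i], its range no longer depends on [k], and sums over [k] and [i] can be exchanged. *)
Lemma sum_window (f : nat -> R) k M N : (M <= k)%N -> (k + M < N)%N ->
  (forall j, (j + M < k)%N -> f j = 0) -> (forall j, (k + M < j)%N -> f j = 0) ->
  \sum_(j < N) f j = \sum_(i < M.*2.+1) f (k - M + i)%N.
Proof.
move=> Mk kN f1 f2; rewrite -(big_mkord xpredT f).
rewrite (@big_cat_nat _ _ _ (k - M)) ?leq0n//=; last by lia.
rewrite [X in X + _]big_nat_cond big1 ?add0r; last first.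
  by move=> i /andP[/andP[_ iM] _]; apply: f1; lia.
rewrite (@big_cat_nat _ _ _ (k + M).+1)//=; last by lia.
rewrite [X in _ + X]big_nat_cond [X in _ + X]big1 ?addr0; last first.
  by move=> i /andP[/andP[iM _] _]; apply: f2; lia.
rewrite -{1}[(k - M)%N]add0n big_addn big_mkord.
have -> : ((k + M).+1 - (k - M))%N = M.*2.+1 by lia.
by apply: eq_bigr => i _; rewrite addnC.
Qed.

Lemma continuous_translate f c : continuous f -> continuous (fun x => f (x + c)).
Proof.
move=> cf x; apply: (@continuous_comp _ _ _ (fun y => y + c) f); last exact: cf.
by apply: cvgD; [exact: cvg_id|exact: cvg_cst].
Qed.

Definition diff2 f (h x : R) : R := f (x + h) + f (x - h) - 2 * f x.

Lemma is_derive_diff2 f g h x : (forall x, is_derive x (1 : R) f (g x)) ->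
  is_derive x (1 : R) (diff2 f h) (diff2 g h x).
Proof.
move=> fg; exact: (is_deriveB (is_deriveD (is_derive_translate h fg x)
  (is_derive_translate (- h) fg x)) (is_deriveZ 2 (fg x))).
Qed.

Lemma diff2_continuous f h : continuous f -> continuous (diff2 f h).
Proof.
move=> cf x; apply: cvgB; last by apply: cvgMr; exact: cf.
by apply: cvgD; exact: continuous_translate.
Qed.

End Calculus.

(** * The ramp function and its second differences *)

Section Ramp.
Context {R : realType} (delta : R).
Hypothesis delta0 : 0 < delta.

(** This is min(max(x, 0), delta), the length of the part of [0, delta] to the left of [x]. In terms
    of absolute values, continuity is immediate and every sign case is linear. *)
Definition ramp (x : R) : R := (delta + `|x| - `|x - delta|) / 2.

Lemma ramp_le0 x : x <= 0 -> ramp x = 0.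
Proof.
by move: delta0; rewrite /ramp => ? ?;
  case: (ger0P x); case: (ger0P (x - delta)) => ? ?; lra.
Qed.

Lemma ramp_ge x : delta <= x -> ramp x = delta.
Proof.
by move: delta0; rewrite /ramp => ? ?;
  case: (ger0P x); case: (ger0P (x - delta)) => ? ?; lra.
Qed.

Lemma ramp_mid x : 0 <= x <= delta -> ramp x = x.
Proof.
by move: delta0; rewrite /ramp => ? ?;
  case: (ger0P x); case: (ger0P (x - delta)) => ? ?; lra.
Qed.

Lemma ramp_mono x y : x <= y -> ramp x <= ramp y.
Proof.
by move: delta0; rewrite /ramp => ? ?; case: (ger0P x); case: (ger0P (x - delta));
  case: (ger0P y); case: (ger0P (y - delta)) => ? ? ? ?; lra.
Qed.

Lemma ramp_continuous : continuous ramp.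
Proof.
move=> x; apply: cvgMl; apply: cvgB; last first.
  by apply: cvg_norm; apply: cvgB; [exact: cvg_id|exact: cvg_cst].
by apply: cvgD; [exact: cvg_cst|apply: cvg_norm; exact: cvg_id].
Qed.

Variables (Rm : R -> R) (h : R).
Hypothesis dRm : forall x, is_derive x (1 : R) Rm (ramp x).
Hypothesis h0 : 0 <= h.

(** The derivative [diff2 ramp h] equals [ramp (x - h) - delta] on [delta, oo) and [ramp (x + h)] on
    (-oo, 0], so it is nondecreasing on each half-line. *)
Lemma ramp_diff2_tangent x y : delta <= x /\ delta <= y \/ x <= 0 /\ y <= 0 ->
  diff2 Rm h x + diff2 ramp h x * (y - x) <= diff2 Rm h y.
Proof.
move=> xy; move: delta0 h0 => d0 hp.
have mono z w : delta <= z /\ delta <= w \/ z <= 0 /\ w <= 0 -> z <= w ->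
    diff2 ramp h z <= diff2 ramp h w.
  rewrite /diff2 => -[] [z0 w0] zw.
    rewrite !(ramp_ge (x := _ + h)) ?(ramp_ge (x := z)) ?(ramp_ge (x := w)); try lra.
    have := @ramp_mono (z - h) (w - h); lra.
  rewrite !(ramp_le0 (x := _ - h)) ?(ramp_le0 (x := z)) ?(ramp_le0 (x := w)); try lra.
  have := @ramp_mono (z + h) (w + h); lra.
apply: (tangent_le (fun w => is_derive_diff2 h w dRm)) => z z1 z2.
  by apply: mono => //; case: xy; lra.
by apply: mono => //; case: xy; lra.
Qed.

End Ramp.

(** * The energy identity *)

Section Sawtooth.
Context {R : realType} (Lambda delta : R).
Implicit Types (u v : R -> R) (a b : nat -> R).

(* Only the descending intervals from [a 0] on are listed: [saw_per] determines the rest. *)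
Record sawtooth (T : R) (L : nat) u a : Prop := Sawtooth {
  saw_cont : continuous u;
  saw_per : forall x, u (x + T) = u x;
  saw_gap : forall k, a k + delta <= a k.+1;
  saw_shift : forall k, a (k + L)%N = a k + T;
  saw_down : forall k x, a k <= x <= a k + delta ->
    u x = u (a k) + - Lambda * (x - a k);
  saw_up : forall k x, a k + delta <= x <= a k.+1 ->
    u x = u (a k + delta) + 1 * (x - (a k + delta)) }.

Lemma saw_ge T L u a k i : sawtooth T L u a -> a k + i%:R * delta <= a (k + i)%N.
Proof.
move=> ua; elim: i => [|i IH]; first by rewrite mul0r addr0 addn0.
rewrite addnS; apply: le_trans (saw_gap ua _).
by rewrite -natr1 mulrDl mul1r addrA lerD2r.
Qed.

(** The slope is 1, lowered by [Lambda + 1] on descending intervals; the ramps add up the descending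
    length already passed. *)
Lemma saw_sum T L u a N x : 0 < delta -> sawtooth T L u a -> a 0%N <= x <= a N ->
  u x = u (a 0%N) + (x - a 0%N)
        - (Lambda + 1) * \sum_(j < N) ramp delta (x - a j).
Proof.
move=> d0 ua; elim: N x => [|N IH] x /andP[x0 xN].
  have -> : x = a 0%N by apply/eqP; rewrite eq_le xN x0.
  by rewrite big_ord0; ring.
have a0N : a 0%N <= a N.
  have := saw_ge 0 N ua; rewrite add0n.
  have : 0 <= N%:R * delta by rewrite mulr_ge0// ltW.
  by lra.
rewrite big_ord_recr/=.
have [xaN|/ltW aNx] := leP x (a N).
  by rewrite ramp_le0 ?subr_le0// addr0 IH// x0.
(* From [a N] on, the first [N] ramps have all reached their maximal value, so only the last one
   still varies. *)
have saturated y : a N <= y -> \sum_(j < N) ramp delta (y - a j) = N%:R * delta.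
  move=> Ny; rewrite (eq_bigr (fun=> delta)).
    by rewrite sumr_const card_ord mulr_natl.
  move=> j _; apply: ramp_ge => //.
  have := saw_ge j.+1 (N - j.+1) ua; rewrite subnKC//.
  have : 0 <= (N - j.+1)%:R * delta by rewrite mulr_ge0// ltW.
  have := saw_gap ua j; lra.
have uN := IH (a N); rewrite a0N lexx in uN.
rewrite saturated//; rewrite saturated// in uN.
have [xd|/ltW xd] := leP x (a N + delta).
  rewrite ramp_mid//; last by apply/andP; split; lra.
  by rewrite (saw_down ua (k := N)) ?aNx// uN//; ring.
rewrite ramp_ge//; last by lra.
rewrite (saw_up ua (k := N)) ?xd// (saw_down ua (k := N)); last by apply/andP; split; lra.
by rewrite uN//; ring.
Qed.

End Sawtooth.

Section Energy.
Context {R : realType} (Lambda delta T : R) (L : nat) (u : R -> R) (a : nat -> R).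
Hypothesis delta0 : 0 < delta.
Hypothesis ua : sawtooth Lambda delta T L u a.
Variables (U W : R -> R).
Hypothesis dU : forall x, is_derive x (1 : R) U (u x).
Hypothesis dW : forall x, is_derive x (1 : R) W (U x).

Lemma diff2U_periodic h x : diff2 U h (x + T) = diff2 U h x.
Proof.
rewrite /diff2 (addrAC x T h) (addrAC x T (- h)).
by rewrite !(derive_periodic dU (saw_per ua)); ring.
Qed.

(** [U] gains a constant over a period, hence [W] gains an affine function, and second differences
    annihilate affine functions. *)
Lemma diff2W_periodic h x : diff2 W h (x + T) = diff2 W h x.
Proof.
pose c := U T - U 0.
pose k y := W (y + T) - W y - c * y.
have dk y : is_derive y (1 : R) k 0.
  have := is_deriveB (is_deriveB (is_derive_translate T dW y) (dW y))
    (is_deriveZ c (is_derive_id y 1)).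
  move=> /is_derive_eq; apply.
  by rewrite (derive_periodic dU (saw_per ua)) /GRing.scale/= /c; ring.
have K y : W (y + T) = W y + c * y + k 0.
  by have := is_derive_0_is_cst y 0 dk; rewrite {1}/k; lra.
rewrite /diff2 (addrAC x T h) (addrAC x T (- h)) !K; ring.
Qed.

Variables (h : R) (Z : R -> R).
Hypothesis dZ : forall x, is_derive x (1 : R) Z ((u (x + h) - u x) ^+ 2).

(* Integration by parts: on a segment of slope [p], the function [E(x+h) - E(x) - u * diff2 U]
   has derivative [(u(x+h) - u(x))^2 - p * diff2 U]. *)
Lemma saw_energy (n : nat) :
  Z (a n + T) - Z (a n) =
  - (Lambda + 1) * \sum_(k < L) (diff2 W h (a (n + k)%N + delta) - diff2 W h (a (n + k)%N)).
Proof.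
have cu := saw_cont ua.
have [E dE] : exists E, forall x, is_derive x (1 : R) E (u x ^+ 2 - u x * u (x - h)).
  apply: antiderivative => x.
  by apply: cvgB; apply: (cvgM (cu x)); [exact: cu|exact: continuous_translate].
(* As [diff2 W h] is a primitive of [diff2 U h], the derivative of [Psi] is (1 - p) times
   [diff2 U h]: it vanishes on ascending segments and has the factor [Lambda + 1] on descending
   ones. *)
pose Psi x := E (x + h) - E x - u x * diff2 U h x + diff2 W h x - Z x.
have cPsi : continuous Psi.
  have cE := is_derive_continuous dE.
  move=> x; apply: cvgB; last exact: is_derive_continuous dZ x.
  apply: cvgD; last by apply: diff2_continuous; exact: is_derive_continuous dW.
  apply: cvgB; last first.
    by apply: (cvgM (cu x)); apply: diff2_continuous; exact: is_derive_continuous dU.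
  by apply: cvgB; [exact: is_derive_continuous (is_derive_translate h dE) x|exact: cE].
have cW := diff2_continuous (h := h) (is_derive_continuous dW).
have seg p x y : x <= y ->
    (forall z, x <= z <= y -> u z = u x + p * (z - x)) ->
    Psi y - (1 - p) * diff2 W h y = Psi x - (1 - p) * diff2 W h x.
  move=> xy up.
  pose k z := Psi z - (1 - p) * diff2 W h z.
  have ck : continuous k.
    by move=> z; apply: cvgB; [exact: cPsi|apply: cvgMr; exact: cW].
  apply: (@derive0_cst_segment R k x y xy (continuous_subspaceT ck)).
  move=> z xzy; have du : is_derive z (1 : R) u p := is_derive_affine xzy up.
  have dY := is_derive_diff2 h z dW.
  have dUU := is_derive_diff2 h z dU.
  have := is_deriveB (is_deriveB (is_deriveD (is_deriveB (is_deriveB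
    (is_derive_translate h dE z) (dE z)) (is_deriveM du dUU)) dY) (dZ z))
    (is_deriveZ (1 - p) dY).
  move=> /is_derive_eq; apply.
  by rewrite /diff2 /GRing.scale/= addrK; ring.
have sum m : Psi (a (n + m)%N) - Psi (a n) =
    (Lambda + 1) * \sum_(k < m) (diff2 W h (a (n + k)%N + delta) - diff2 W h (a (n + k)%N)).
  elim: m => [|m IH]; first by rewrite addn0 big_ord0; ring.
  rewrite big_ord_recr/= mulrDr -IH addnS.
  have s1 := seg (- Lambda) (a (n + m)%N) (a (n + m)%N + delta).
  have s2 := seg 1 (a (n + m)%N + delta) (a (n + m).+1).
  rewrite lerDl in s1.
  have {}s1 := s1 (ltW delta0) (saw_down ua (k := _)).
  have {}s2 := s2 (saw_gap ua _) (saw_up ua (k := _)).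
  lra.
(* Every term of [Psi] other than [Z] is periodic; the constant gained by [E] cancels in E(x+h) -
   E(x). *)
have PsiT : Psi (a n + T) - Psi (a n) = - (Z (a n + T) - Z (a n)).
  rewrite /Psi diff2W_periodic diff2U_periodic (saw_per ua) (addrAC _ T h).
  have Eper x : u (x + T) ^+ 2 - u (x + T) * u (x + T - h) = u x ^+ 2 - u x * u (x - h).
    by rewrite (addrAC x T) !(saw_per ua).
  by rewrite !(derive_periodic dE Eper); ring.
by rewrite mulNr -sum (saw_shift ua) PsiT opprK.
Qed.

End Energy.

(** * Comparison with equidistant intervals *)

Section Comparison.
Context {R : realType} (Lambda delta T : R) (L : nat).
Hypothesis delta0 : 0 < delta.
Variables (Rm : R -> R).
Hypothesis dRm : forall x, is_derive x (1 : R) Rm (ramp delta x).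

(** [G] is a primitive of the formula in [saw_sum]. Its second difference loses the affine part, the
    quadratic part contributes h^2, and the ramps contribute their second differences. The formula
    is valid while [x - h] and [x + h] stay within the listed stretch. *)
Lemma saw_diff2U (u U : R -> R) (a : nat -> R) (h x : R) N :
  sawtooth Lambda delta T L u a -> (forall x, is_derive x (1 : R) U (u x)) ->
  0 <= h -> a 0%N <= x - h -> x + h <= a N ->
  diff2 U h x = h ^+ 2 - (Lambda + 1) * \sum_(j < N) diff2 Rm h (x - a j).
Proof.
move=> ua dU h0 ax xa.
pose G y := u (a 0%N) * y + 2^-1 * ((y - a 0%N) * (y - a 0%N))
            - (Lambda + 1) * \sum_(j < N) Rm (y - a j).
pose k y := U y - G y.
have dG y : is_derive y (1 : R) G (u (a 0%N) + (y - a 0%N)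
              - (Lambda + 1) * \sum_(j < N) ramp delta (y - a j)).
  have dy := is_deriveB (is_derive_id y (1 : R)) (is_derive_cst (a 0%N) y 1).
  have dS := @is_derive_sum_fun R N (fun j y => Rm (y - a j))
    (fun j y => ramp delta (y - a j)) y (fun j => is_derive_translate (- a j) dRm y).
  have := is_deriveB (is_deriveD (is_deriveZ (u (a 0%N)) (is_derive_id y (1 : R)))
    (is_deriveZ 2^-1 (is_deriveM dy dy))) (is_deriveZ (Lambda + 1) dS).
  by move=> /is_derive_eq; apply; rewrite /GRing.scale/= ?fctE/= /cst; field.
have kE y : a 0%N <= y <= a N -> k y = k (a 0%N).
  move=> /andP[y0 yN]; apply: derive0_cst_segment => //.
    apply: continuous_subspaceT.
    by apply: (is_derive_continuous (g := fun y => _)) => z; apply: is_deriveB.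
  move=> z /andP[z0 zy]; have := is_deriveB (dU z) (dG z).
  move=> /is_derive_eq; apply; rewrite (saw_sum delta0 ua (N := N) (x := z)) ?subrr//.
  by apply/andP; split; lra.
have k1 : k (x + h) = k (a 0%N) by apply: kE; apply/andP; split; lra.
have k2 : k (x - h) = k (a 0%N) by apply: kE; apply/andP; split; lra.
have k3 : k x = k (a 0%N) by apply: kE; apply/andP; split; lra.
have SE : \sum_(j < N) diff2 Rm h (x - a j) =
    \sum_(j < N) Rm (x + h - a j) + \sum_(j < N) Rm (x - h - a j)
    - 2 * \sum_(j < N) Rm (x - a j).
  rewrite mulr_sumr -big_split -sumrB; apply: eq_bigr => j _ /=.
  by rewrite /diff2 (addrAC x) (addrAC x (- h)).
rewrite SE /diff2; move: k1 k2 k3; rewrite /k /G; lra.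
Qed.

Variables (P : R) (u v : R -> R) (a b : nat -> R).
Hypothesis deltaP : delta <= P.
Hypothesis TE : T = L%:R * P.
Hypothesis ua : sawtooth Lambda delta T L u a.
Hypothesis vb : sawtooth Lambda delta T L v b.
Hypothesis bP : forall k, b k.+1 = b k + P.

Let bE k : b k = b 0%N + k%:R * P.
Proof.
elim: k => [|k IH]; first by rewrite mul0r addr0.
by rewrite bP IH -natr1; ring.
Qed.

Variables (h s : R) (M n : nat).
Hypothesis h0 : 0 <= h.
Hypothesis s0d : 0 <= s <= delta.
Hypothesis hM : h + delta <= M%:R * delta.
Hypothesis Mn : (M <= n)%N.

(** With [d k] the deviation of [a k] from k P, the tangent inequality at the equidistant difference
    [z0 k j] has linear term proportional to [d k - d j], with a coefficient depending only on k -
    j. Summed over a period these terms cancel, since [d] is L-periodic. The range of [j] contains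
    the whole band of width [M] around each of the [L] indices [n + k]. *)
Lemma ramp_diff2_sum_le :
  \sum_(k < L) \sum_(j < n + L + M) diff2 Rm h (b (n + k)%N + s - b j) <=
  \sum_(k < L) \sum_(j < n + L + M) diff2 Rm h (a (n + k)%N + s - a j).
Proof.
move: delta0 deltaP h0 s0d hM => d0 dP hp /andP[sp sd] hMd.
pose d k := a k - k%:R * P.
have dL k : d (k + L)%N = d k.
  by rewrite /d (saw_shift ua) TE natrD; ring.
pose z0 (k j : nat) := (k%:R - j%:R) * P + s.
(* By the choice of [M], the points z0 - h, z0 and z0 + h all lie on the same flat part of the
   ramp. *)
have dz0 k j : (j + M < k)%N || (k + M < j)%N -> diff2 (ramp delta) h (z0 k j) = 0.
  case/orP => kj.
    have kjP : (M%:R + 1) * P <= (k%:R - j%:R) * P.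
      apply: ler_wpM2r; first by lra.
      have : (j%:R + M%:R + 1 : R) <= k%:R by rewrite -natrD natr1 ler_nat.
      lra.
    rewrite /diff2 /z0 !ramp_ge//; nra.
  have kjP : (k%:R - j%:R) * P <= - (M%:R + 1) * P.
    apply: ler_wpM2r; first by lra.
    have : (k%:R + M%:R + 1 : R) <= j%:R by rewrite -natrD natr1 ler_nat.
    lra.
  rewrite /diff2 /z0 !ramp_le0//; nra.
have tangent k j : diff2 Rm h (z0 k j) + diff2 (ramp delta) h (z0 k j) * (d k - d j) <=
    diff2 Rm h (a k + s - a j).
  have -> : d k - d j = (a k + s - a j) - z0 k j by rewrite /d /z0; ring.
  have [kj|kj|->] := ltngtP k j.
  - apply: ramp_diff2_tangent => //; right.
    have := saw_ge k.+1 (j - k.+1) ua; rewrite subnKC//.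
    have : 0 <= (j - k.+1)%:R * delta by rewrite mulr_ge0// ltW.
    have := saw_gap ua k.
    have : (k%:R - j%:R) * P <= -1 * P.
      apply: ler_wpM2r; first by lra.
      have : (k%:R + 1 : R) <= j%:R by rewrite natr1 ler_nat.
      lra.
    by rewrite /z0; split; lra.
  - apply: ramp_diff2_tangent => //; left.
    have := saw_ge j.+1 (k - j.+1) ua; rewrite subnKC//.
    have : 0 <= (k - j.+1)%:R * delta by rewrite mulr_ge0// ltW.
    have := saw_gap ua j.
    have : 1 * P <= (k%:R - j%:R) * P.
      apply: ler_wpM2r; first by lra.
      by rewrite lerBrDr addrC natr1 ler_nat.
    by rewrite /z0; split; lra.
  (* On the diagonal the argument is [s], which may lie outside both convex regions, but it is the
     same for both configurations. *)
  - have -> : a j + s - a j = z0 j j by rewrite /z0; ring.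
    by rewrite subrr mulr0 addr0.
have bz k j : b k + s - b j = z0 k j by rewrite /z0 !(bE k) !(bE j); ring.
pose C := \sum_(k < L) \sum_(j < n + L + M)
  diff2 (ramp delta) h (z0 (n + k)%N j) * (d (n + k)%N - d j).
have cancel : C = 0.
  rewrite /C.
  under eq_bigr => k _.
    rewrite (@sum_window _ (fun j => diff2 (ramp delta) h (z0 (n + k)%N j) * (d (n + k)%N - d j))
      (n + k) M); first over.
    - by lia.
    - by have := ltn_ord k; lia.
    - by move=> j jk; rewrite dz0 ?mul0r// jk.
    - by move=> j jk; rewrite dz0 ?mul0r// jk orbT.
  rewrite exchange_big big1// => i _ /=.
  (* At fixed offset [i] the coefficient is the same for all [k], which leaves the difference of two
     sums of [d] over full periods. *)
  pose c := diff2 (ramp delta) h ((M%:R - i%:R) * P + s).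
  transitivity (\sum_(k < L) c * (d (n + k)%N - d (n - M + i + k)%N)).
    apply: eq_bigr => k _.
    have -> : (n + k - M + i = n - M + i + k)%N by lia.
    have zE : z0 (n + k)%N (n - M + i + k)%N = (M%:R - i%:R) * P + s.
      by rewrite /z0 !natrD natrB//; ring.
    by rewrite zE.
  by rewrite -mulr_sumr sumrB !sum_periodic_shift// subrr mulr0.
suff : \sum_(k < L) \sum_(j < n + L + M) diff2 Rm h (b (n + k)%N + s - b j) + C <=
    \sum_(k < L) \sum_(j < n + L + M) diff2 Rm h (a (n + k)%N + s - a j).
  by rewrite cancel addr0.
rewrite -big_split/=; apply: ler_sum => k _.
rewrite -big_split/=; apply: ler_sum => j _.
by rewrite bz; exact: tangent.
Qed.

(** The factor -(Lambda + 1) in [saw_diff2U] reverses the comparison of the ramp sums. The [M]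
    intervals before and after the period leave room for the displacement [h]. *)
Lemma diff2U_sum_le (U V : R -> R) :
  0 <= Lambda + 1 ->
  (forall x, is_derive x (1 : R) U (u x)) -> (forall x, is_derive x (1 : R) V (v x)) ->
  \sum_(k < L) diff2 U h (a (n + k)%N + s) <= \sum_(k < L) diff2 V h (b (n + k)%N + s).
Proof.
move=> Lp dU dV; move: delta0 deltaP h0 s0d hM => d0 dP hp /andP[sp sd] hMd.
have E w c W : sawtooth Lambda delta T L w c -> (forall x, is_derive x (1 : R) W (w x)) ->
    \sum_(k < L) diff2 W h (c (n + k)%N + s) = \sum_(k < L) h ^+ 2
    - (Lambda + 1) * \sum_(k < L) \sum_(j < n + L + M) diff2 Rm h (c (n + k)%N + s - c j).
  move=> wc dW; rewrite mulr_sumr -sumrB; apply: eq_bigr => k _.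
  have nd : 0 <= (n - M)%:R * delta by rewrite mulr_ge0// ltW.
  have kd : 0 <= (L - k.+1)%:R * delta by rewrite mulr_ge0// ltW.
  have id : 0 <= k%:R * delta by rewrite mulr_ge0// ltW.
  apply: (saw_diff2U wc dW) => //.
    have := saw_ge 0 (n + k) wc; rewrite add0n natrD.
    move: nd; rewrite natrB//; lra.
  have := saw_gap wc (n + k).
  have := saw_ge (n + k).+1 (L - k.+1 + M) wc.
  have -> : ((n + k).+1 + (L - k.+1 + M) = n + L + M)%N by have := ltn_ord k; lia.
  rewrite natrD; lra.
by rewrite (E _ _ _ ua dU) (E _ _ _ vb dV) lerD2l lerN2 ler_wpM2l// ramp_diff2_sum_le.
Qed.

End Comparison.

Section EnergyComparison.
Context {R : realType} (Lambda delta T P : R) (L : nat).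
Variables (u v : R -> R) (a b : nat -> R).
Hypothesis Lambda0 : 0 < Lambda.
Hypothesis delta0 : 0 < delta.
Hypothesis deltaP : delta <= P.
Hypothesis TE : T = L%:R * P.
Hypothesis ua : sawtooth Lambda delta T L u a.
Hypothesis vb : sawtooth Lambda delta T L v b.
Hypothesis bP : forall k, b k.+1 = b k + P.

Lemma energy_le (h : R) (Zu Zv : R -> R) : 0 <= h ->
  (forall x, is_derive x (1 : R) Zu ((u (x + h) - u x) ^+ 2)) ->
  (forall x, is_derive x (1 : R) Zv ((v (x + h) - v x) ^+ 2)) ->
  Zv T - Zv 0 <= Zu T - Zu 0.
Proof.
move=> h0 dZu dZv; move: delta0 Lambda0 => d0 L0.
have [Rm dRm] := antiderivative (@ramp_continuous R delta).
have [U dU] := antiderivative (saw_cont ua).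
have [V dV] := antiderivative (saw_cont vb).
have [W dW] := antiderivative (is_derive_continuous dU).
have [X dX] := antiderivative (is_derive_continuous dV).
pose M := `|Num.ceil ((h + delta) / delta)|%N.
have hM : h + delta <= M%:R * delta.
  rewrite -ler_pdivrMr// natr_absz ger0_norm; last first.
    by rewrite ceil_ge0 (lt_le_trans (ltrN10 _))// divr_ge0//; lra.
  by have /andP[] := ceil_itv ((h + delta) / delta).
have shift (w Z : R -> R) x : (forall x, w (x + T) = w x) ->
    (forall x, is_derive x (1 : R) Z ((w (x + h) - w x) ^+ 2)) ->
    Z T - Z 0 = Z (x + T) - Z x.
  move=> wT dZ; rewrite (derive_periodic dZ); first by ring.
  by move=> y; rewrite (addrAC y) !wT.
(* The period is moved to start at the interval of index [M], so that the list, which begins at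
   index 0, reaches far enough to the left. *)
rewrite (shift u Zu (a M) (saw_per ua))// (shift v Zv (b M) (saw_per vb))//.
rewrite (saw_energy d0 ua dU dW dZu) (saw_energy d0 vb dV dX dZv).
rewrite !mulNr lerN2 ler_pM2l; last by lra.
(* The increment of [G] from 0 to [delta] is the energy gap divided by [Lambda + 1]; its derivative
   in [s] is nonnegative by [diff2U_sum_le]. *)
pose G s := \sum_(k < L) (diff2 X h (b (M + k)%N + s) - diff2 W h (a (M + k)%N + s)).
have dG s : is_derive s (1 : R) G
    (\sum_(k < L) (diff2 V h (b (M + k)%N + s) - diff2 U h (a (M + k)%N + s))).
  apply: (@is_derive_sum_fun R L
    (fun k s => diff2 X h (b (M + k)%N + s) - diff2 W h (a (M + k)%N + s))
    (fun k s => diff2 V h (b (M + k)%N + s) - diff2 U h (a (M + k)%N + s))) => k.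
  have dX2 x := is_derive_diff2 h x dX; have dW2 x := is_derive_diff2 h x dW.
  have := is_deriveB (is_derive_translate (b (M + k)%N) dX2 s)
     (is_derive_translate (a (M + k)%N) dW2 s).
  rewrite ![s + _]addrC; congr is_derive; apply/funext => y.
  by rewrite -[in RHS](addrC y) -[in RHS](addrC y).
have : G 0 <= G delta.
  have cG (i : interval R) : {within [set` i], continuous G}.
    exact: continuous_subspaceT (is_derive_continuous dG).
  have [c] := MVT_segment (ltW d0) (fun z _ => dG z) (cG _).
  rewrite in_itv/= => c0d GE; rewrite -subr_ge0 GE; apply: mulr_ge0; last by rewrite subr0 ltW.
  rewrite sumrB subr_ge0.
  by apply: (diff2U_sum_le d0 dRm deltaP TE ua vb bP h0 c0d hM (leqnn M) _ dU dV); lra.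
move=> G0d; rewrite -subr_ge0 -sumrB.
move: G0d; rewrite -subr_ge0 /G -sumrB => /le_trans; apply.
by apply: ler_sum => k _; rewrite !addr0; lra.
Qed.

End EnergyComparison.

(** * Structure of admissible functions *)

Section Structure.
Context {R : realType}.
Local Notation mu := (@lebesgue_measure R).

Lemma ae_exists_oo (Q : R -> Prop) (x y : R) : {ae mu, forall z, Q z} -> x < y ->
  exists2 z, x < z < y & Q z.
Proof.
move=> aeQ xy; apply: contrapT => nQ.
have xy0 : mu `]x, y[%classic = 0%E.
  apply/negligibleP; first exact: measurable_itv.
  apply: negligibleS aeQ => z /=; rewrite in_itv/= => xzy Qz.
  by apply: nQ; exists z.
move: xy0; rewrite lebesgue_measure_itv/= lte_fin xy -EFinB => /eqP.
by rewrite eqe subr_eq0 gt_eqF.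
Qed.

(** The supremum of the points where [f] is at most [f a] is such a point by continuity, and can be
    moved right unless it is [b]. This turns the one-sided information of [right_affine] into global
    bounds. *)
Lemma right_nonincreasing (f : R -> R) (a b : R) : a <= b -> continuous f ->
  (forall x, a <= x < b -> exists2 e, 0 < e & forall y, x <= y <= x + e -> f y <= f x) ->
  f b <= f a.
Proof.
move=> ab cf rf.
pose S := [set t | a <= t <= b /\ f t <= f a].
have Sa : S a by rewrite /S/= lexx ab.
have supS : has_sup S.
  by split; [exists a|exists b => t [/andP[_ ->]]].
have ac : a <= sup S by apply: ub_le_sup => //; have [] := supS.
have cb : sup S <= b by apply: ge_sup; [exists a|move=> t [/andP[_ ->]]].
have fc : f (sup S) <= f a.
  rewrite leNgt; apply/negP => fac.
  have : \forall z \near sup S, f a < f z.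
    have := cf (sup S) => /cvgr_gt; apply; exact: fac.
  move=> [e /= e0 He].
  have [t [abt ft] tc] := sup_adherent e0 supS.
  have ts : t <= sup S by apply: ub_le_sup; [have [] := supS|split].
  suff : f a < f t by rewrite ltNge ft.
  by apply: He; rewrite /= ger0_norm; lra.
have [cb'|bc] := ltP (sup S) b; last by have -> : b = sup S by apply/eqP; rewrite eq_le bc.
have [|e e0 He] := rf (sup S); first by rewrite ac.
pose t := Num.min (sup S + e) b.
have [t1 t2 t3] : [/\ sup S < t, t <= sup S + e & t <= b].
  by rewrite /t lt_min !ge_min !lexx ?orbT; split => //; apply/andP; split => //; lra.
have : S t.
  split; first by rewrite t3 andbT; lra.
  by apply: le_trans fc; apply: He; rewrite t2 andbT ltW.
by move=> /(ub_le_sup (proj2 supS)); rewrite leNgt t1.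
Qed.

Variables (Lambda delta : R) (u : R -> R).
Hypothesis Lambda0 : 0 < Lambda.
Hypothesis delta0 : 0 < delta.
Hypothesis cu : continuous u.
Hypothesis pu : piecewise_affine u.
Hypothesis du : {ae mu, forall x : R, is_derive x (1:R) u (1:R) \/ is_derive x (1:R) u (- Lambda)}.

(** Breakpoints do not accumulate, so some interval (x, x + e) contains none. There the derivative
    is locally constant, hence constant; the almost everywhere condition, met somewhere in the
    interval, fixes its value, and continuity includes the endpoint [x]. *)
Lemma right_affine x : exists e p, [/\ 0 < e, p = 1 \/ p = - Lambda &
  forall y, x <= y <= x + e -> u y = u x + p * (y - x)].
Proof.
have [B [finB affB]] := pu.
have [e e0 Be] : exists2 e, 0 < e & forall y, x < y < x + e -> ~ B y.
  pose S : set R := (B `&` [set` `[x, x + 1]]) `\ x.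
  have : closed S.
    apply: (proj1 accessible_finite_set_closed); last by apply: finite_setD; exact: finB.
    exact/hausdorff_accessible/norm_hausdorff.
  move=> /closed_openC oS; have : nbhs x (~` S).
    by apply: open_nbhs_nbhs; split => //; rewrite /S => -[_ /=]; exact.
  move=> [e /= e0 He]; exists (Num.min e 1); first by rewrite lt_min e0 ltr01.
  move=> y /andP[xy]; rewrite -ltrBlDl lt_min => /andP[ye y1] By.
  apply: (He y) => /=; first by rewrite distrC gtr0_norm ?subr_gt0.
  split=> [|yx]; last by rewrite /= in yx; rewrite yx ltxx in xy.
  by split => //=; rewrite in_itv/= ltW//=; lra.
have loc y : x < y < x + e -> exists m, \forall z \near y, is_derive z (1 : R) u m.
  move=> /Be /affB[r r0 [m [c uE]]]; exists m.
  near=> z.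
  have zy : `|y - z| < r / 2 by near: z; apply: (nbhsx_ballx y (r / 2)); lra.
  apply: (@is_derive_affine _ u (z - r / 2) (z + r / 2)); first by apply/andP; split; lra.
  move=> t /andP[t1 t2]; move: zy; rewrite ltr_norml => /andP[z1 z2].
  rewrite uE; last by rewrite ltr_norml; apply/andP; split; lra.
  by rewrite uE; [ring|rewrite ltr_norml; apply/andP; split; lra].
pose g := derive1 u.
have gE y m : is_derive y (1 : R) u m -> g y = m.
  by move=> d; rewrite /g derive1E derive_val.
have dg y : x < y < x + e -> is_derive y (1 : R) g 0.
  move=> /loc[m dm].
  have : is_derive y (1 : R) (cst m) 0 by exact: is_derive_cst.
  apply: near_eq_is_derive; near=> z; rewrite /cst; apply/esym/gE.
  by near: z.
pose c := x + e / 2.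
have cin : x < c < x + e by rewrite /c; apply/andP; split; lra.
have gcst y z : x < y -> y <= z -> z < x + e -> g z = g y.
  move=> xy yz ze; apply: derive0_cst_segment => //.
    apply: derivable_within_continuous => t; rewrite in_itv/= => /andP[yt tz].
    by have [] := dg t; [apply/andP; split; lra|].
  by move=> t /andP[yt tz]; apply: dg; apply/andP; split; lra.
have gc y : x < y < x + e -> g y = g c.
  move=> /andP[xy ye]; have /andP[xc ce] := cin.
  by have [yc|/ltW cy] := leP y c; [rewrite (gcst y c)|rewrite (gcst c y)].
have dug y : x < y < x + e -> is_derive y (1 : R) u (g c).
  move=> xy; have [m dm] := loc y xy.
  by rewrite -(gc y xy); have d := nbhs_singleton dm; rewrite (gE _ _ d).
exists (e / 2), (g c); split; first by lra.
  have /(ae_exists_oo du)[z xz] : x < x + e by lra.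
  by have := gc z xz; move=> <- [/gE ->|/gE ->]; [left|right].
move=> y /andP[xy ye]; pose k z := u z - g c * z.
have : k y = k x.
  apply: derive0_cst_segment => //.
    apply: continuous_subspaceT => z; apply: cvgB; first exact: cu.
    by apply: cvgMr; exact: cvg_id.
  move=> z /andP[xz zy]; have xze : x < z < x + e by apply/andP; split; lra.
  have := is_deriveB (dug z xze) (is_deriveZ (g c) (is_derive_id z (1 : R))).
  by move=> /is_derive_eq; apply; rewrite /GRing.scale/= mulr1 subrr.
rewrite /k; lra.
Unshelve. all: by end_near. Qed.

Lemma slope_le1 x y : x <= y -> u y - u x <= y - x.
Proof.
move=> xy; move: Lambda0 => L0.
suff : u y - y <= u x - x by lra.
apply: (@right_nonincreasing (fun z => u z - z)) => //.
  by move=> z; apply: cvgB; [exact: cu|exact: cvg_id].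
move=> z _; have [e [p [e0 pE uE]]] := right_affine z; exists e => // t zt.
rewrite (uE t zt); case/andP: zt => zt _; case: pE => ->; nra.
Qed.

Lemma slope_geN x y : x <= y -> - Lambda * (y - x) <= u y - u x.
Proof.
move=> xy; move: Lambda0 => L0.
suff : - (u y + Lambda * y) <= - (u x + Lambda * x) by lra.
apply: (@right_nonincreasing (fun z => - (u z + Lambda * z))) => //.
  move=> z; apply: cvgN; apply: cvgD; [exact: cu|by apply: cvgMr; exact: cvg_id].
move=> z _; have [e [p [e0 pE uE]]] := right_affine z; exists e => // t zt.
rewrite (uE t zt); case/andP: zt => zt _; case: pE => ->; nra.
Qed.

Variable al : nat -> R.
Hypothesis al_disj : forall i j : nat, i <> j -> forall x y : R,
  (x \in `[al i, al i + delta]) -> (x \in `[al j, al j + delta]) ->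
  (y \in `[al i, al i + delta]) -> (y \in `[al j, al j + delta]) -> x = y.
Hypothesis al_du : {ae mu, forall x : R, is_derive x (1:R) u (- Lambda) <->
  exists k : nat, (x \in `[al k, al k + delta])}.

(** Otherwise [al j] and [al i + delta] would be two distinct common points of the intervals. *)
Lemma al_gap i j : al i < al j -> al i + delta <= al j.
Proof.
move: delta0 => d0 ij; rewrite leNgt; apply/negP => ji.
have nij : i <> j by move=> E; rewrite E ltxx in ij.
have := al_disj nij (x := al j) (y := al i + delta).
rewrite !in_itv/= !lerDl !lexx (ltW delta0) (ltW ij) (ltW ji) /= lerD2r (ltW ij).
by move=> /(_ isT isT isT isT) E; rewrite E ltxx in ji.
Qed.

(** Only the upper bound is new: the right slope at each point of the interval agrees with the
    derivative at nearby points, which is [- Lambda] almost everywhere there. *)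
Lemma slope_al j x : al j <= x <= al j + delta -> u x = u (al j) + - Lambda * (x - al j).
Proof.
move=> /andP[jx xj]; move: Lambda0 => L0.
have := slope_geN jx.
suff : u x + Lambda * x <= u (al j) + Lambda * al j by lra.
apply: (@right_nonincreasing (fun z => u z + Lambda * z)) => //.
  by move=> z; apply: cvgD; [exact: cu|apply: cvgMr; exact: cvg_id].
move=> z /andP[jz zx]; have [e [p [e0 pE uE]]] := right_affine z.
exists e => // t zt.
suff pL : p = - Lambda by rewrite (uE t zt) pL; lra.
pose y := Num.min (z + e) x.
have [y1 y2 y3] : [/\ z < y, y <= z + e & y <= x].
  by rewrite /y lt_min !ge_min !lexx ?orbT; split => //; apply/andP; split => //; lra.
have [w /andP[zw wy] dw] := ae_exists_oo al_du y1.
have d1 : is_derive w (1 : R) u (- Lambda).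
  by apply/dw; exists j; rewrite in_itv/=; apply/andP; split; lra.
have d2 : is_derive w (1 : R) u p.
  by apply: (is_derive_affine (a := z) (b := z + e)) => //; apply/andP; split; lra.
by rewrite -(@derive_val _ _ _ _ _ _ _ d1) -(@derive_val _ _ _ _ _ _ _ d2).
Qed.

(* Descending intervals meet every right neighbourhood of [x]; one starting in (x, x + delta) and
   another one starting between [x] and it would overlap. *)
Lemma right_slopeN x : (forall e, 0 < e -> u (x + e) - u x < e) ->
  exists j, al j <= x < al j + delta.
Proof.
move=> ux; have [e [p [e0 pE uE]]] := right_affine x.
have pL : p = - Lambda.
  case: pE => // p1; have := ux e e0; rewrite uE ?p1; first lra.
  by apply/andP; split; lra.
have near_al d : 0 < d -> exists z j, [/\ x < z < x + d, al j <= z & z <= al j + delta].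
  move=> d0; pose y := Num.min (x + e) (x + d).
  have [y1 y2 y3] : [/\ x < y, y <= x + e & y <= x + d].
    by rewrite /y lt_min !ge_min !lexx ?orbT; split => //; apply/andP; split => //; lra.
  have [w /andP[xw wy] dw] := ae_exists_oo al_du y1.
  have d2 : is_derive w (1 : R) u (- Lambda).
    rewrite -pL; apply: (is_derive_affine (a := x) (b := x + e)) => //.
    by apply/andP; split; lra.
  have [j] := (proj1 dw) d2; rewrite in_itv/= => /andP[j1 j2].
  by exists w, j; split => //; apply/andP; split; lra.
move: delta0 => d0.
have [z [j [/andP[xz zd] jz zj]]] := near_al _ d0.
have [jx|xj] := leP (al j) x; first by exists j; rewrite jx; lra.
have [w [i [/andP[xw wi] iw wi']]] : exists w i,
    [/\ x < w < x + (al j - x), al i <= w & w <= al i + delta].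
  by apply: near_al; lra.
have /al_gap : al i < al j by lra.
by exists i; apply/andP; split; lra.
Qed.

Variables (T : R) (L : nat).
Hypothesis L0 : (0 < L)%N.
Hypothesis TE : T = L%:R * (Lambda + 1) * delta.
Hypothesis uT : forall x, u (x + T) = u x.

(** It has slope 0 where [u] ascends and slope 1 where [u] descends. *)
Let m x := (x - u x) / (Lambda + 1).

Let m_mono x y : x <= y -> m x <= m y.
Proof.
move=> xy; rewrite /m ler_pM2r ?invr_gt0; last by move: Lambda0; lra.
have := slope_le1 xy; lra.
Qed.

Let m_lip x y : x <= y -> m y <= m x + (y - x).
Proof.
move=> xy; move: Lambda0 => La; have La1 : 0 < Lambda + 1 by lra.
have mE z : m z * (Lambda + 1) = z - u z by rewrite divfK// gt_eqF.
rewrite -(ler_pM2r La1) mulrDl !mE.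
have := slope_geN xy; lra.
Qed.

Let m_al j x : al j <= x <= al j + delta -> m x = m (al j) + (x - al j).
Proof.
move=> /slope_al ux; move: Lambda0 => La; rewrite /m ux; field; lra.
Qed.

Let m_shift x : m (x + T) = m x + L%:R * delta.
Proof.
move: Lambda0 => La; rewrite /m uT TE; field; lra.
Qed.

(* [m] is, up to a constant, the measure of the descending set to the left of a point. Defining
   [a k] from [m] alone makes [a (k + L) = a k + T] automatic. *)
Let level k := m (al 0%N) + k%:R * delta.
Let S k := [set x | m x <= level k].
Let a k := sup (S k).

Let has_sup_S k : has_sup (S k).
Proof.
split; first by exists (al 0%N); rewrite /S/= /level lerDl mulr_ge0// ltW.
have mn n : m (al 0%N + n%:R * T) = m (al 0%N) + n%:R * (L%:R * delta).
  elim: n => [|n IH]; first by rewrite !mul0r !addr0.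
  by rewrite -natr1 mulrDl mul1r addrA m_shift IH; ring.
(* Up to this point [m] has gained (k + 1) L delta, more than the k delta allowed by [level k]. *)
exists (al 0%N + k.+1%:R * T) => x; rewrite /S/= => mx.
rewrite leNgt; apply/negP => /ltW/m_mono; rewrite mn => mx'.
have := le_trans mx' mx; rewrite /level lerD2l mulrA ler_pM2r//.
rewrite -natrM ler_nat; apply/negP; rewrite -ltnNge.
by rewrite leq_pmulr.
Qed.

(** [a] is a generalised inverse of the nondecreasing [m]; the Lipschitz bound [m_lip] shows that
    the supremum is attained. *)
Let aP k x : (m x <= level k) = (x <= a k).
Proof.
apply/idP/idP => [mx|xa]; first by apply: ub_le_sup => //; exact: (has_sup_S k).2.
apply/ler_addgt0Pr => e e0.
have [y Sy ay] := sup_adherent e0 (has_sup_S k).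
have [xy|/ltW yx] := leP x y.
  by have := m_mono xy; rewrite /S/= in Sy; lra.
have := m_lip yx; rewrite /S/= in Sy; rewrite -/(a k) in ay; lra.
Qed.

Let ma k : m (a k) = level k.
Proof.
apply/eqP; rewrite eq_le aP lexx/=; apply/ler_addgt0Pr => e e0.
have : ~~ (m (a k + e) <= level k) by rewrite aP -ltNge ltrDl.
rewrite -ltNge => mae; have ae : a k <= a k + e by rewrite lerDl ltW.
have := m_lip ae; lra.
Qed.

(** [a k] is the last point at its level, so [m] increases strictly to its right and [u] falls short
    of slope 1 there. *)
Let a_right k : exists j, al j <= a k < al j + delta.
Proof.
apply: right_slopeN => e e0.
have : ~~ (m (a k + e) <= level k) by rewrite aP -ltNge ltrDl.
rewrite -ma -ltNge /m ltr_pM2r ?invr_gt0; last by move: Lambda0; lra.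
by lra.
Qed.

(** If [a k] were beyond the left end [al j] of its interval, [m (al j)] would be below [level k].
    But that level is already reached at [al 0] when k = 0, and otherwise at the end of the interval
    starting at the preceding [a]; as intervals do not overlap, [al j] is not to the left of that
    point. *)
Let a_al k : exists j, a k = al j.
Proof.
have step k' i : m (al i) = level k' - delta -> al i + delta <= a k' -> exists j, a k' = al j.
  move=> mi ia; have [j /andP[ja aj]] := a_right k'; exists j.
  apply/eqP; rewrite eq_le ja andbT leNgt; apply/negP => ja'.
  have [ji|ij] := leP (al j) (al i); first by lra.
  have := m_mono (al_gap ij); rewrite (m_al (j := i)); last first.
    by move: delta0 => ?; apply/andP; split; lra.
  have := ma k'; rewrite (m_al (j := j)); last by apply/andP; split; lra.
  by lra.
elim: k => [|k [i ai]].
  have [j /andP[ja aj]] := a_right 0; exists j.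
  apply/eqP; rewrite eq_le ja andbT leNgt; apply/negP => ja'.
  have a0 : al 0%N <= a 0 by rewrite -aP /level mul0r addr0.
  have [ij|ji] := leP (al 0%N) (al j).
    have := m_mono ij; have := ma 0; rewrite (m_al (j := j)); last by apply/andP; split; lra.
    by rewrite /level mul0r addr0; lra.
  have := al_gap ji; lra.
apply: (step _ i); first by rewrite -ai ma /level -natr1; ring.
rewrite -aP (m_al (j := i)); last by move: delta0 => ?; apply/andP; split; lra.
by rewrite -ai ma /level -natr1; lra.
Qed.

Lemma sawtooth_exists : exists a, sawtooth Lambda delta T L u a.
Proof.
exists a; move: delta0 => d0.
have m_a k x : a k <= x <= a k + delta -> m x = m (a k) + (x - a k).
  by have [j ->] := a_al k; exact: m_al.
have gap k : a k + delta <= a k.+1.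
  rewrite -aP (m_a k); last by apply/andP; split; lra.
  by rewrite ma /level -natr1; lra.
split => //.
(* By [aP] and the shift rule for [m], the two numbers have the same lower bounds. *)
- move=> k; have iff x : (x <= a (k + L)) = (x <= a k + T).
    rewrite -aP -(lerBlDr x T) -aP.
    have := m_shift (x - T); rewrite subrK => ->.
    by rewrite /level natrD mulrDl addrA lerD2r.
  by apply/eqP; rewrite eq_le -iff lexx iff lexx.
- by move=> k x; have [j ->] := a_al k; exact: slope_al.
move=> k x /andP[x1 x2].
(* [m] takes the same value at the end of one interval and at the start of the next; being monotone
   it is constant between them, so [u] has slope 1 there. *)
have mad : m (a k + delta) = level k.+1.
  rewrite (m_a k); last by apply/andP; split; lra.
  by rewrite ma /level -natr1; ring.
have : m x = m (a k + delta).
  by apply/eqP; rewrite eq_le (m_mono x1) andbT mad -(ma k.+1) m_mono.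
rewrite /m => /(congr1 (fun z => z * (Lambda + 1))); rewrite !divfK; last 2 first.
- by move: Lambda0; lra.
- by move: Lambda0; lra.
lra.
Qed.

End Structure.

Lemma admissible_sawtooth (R : realType) (Lambda delta : R) (L : nat) (u : R -> R) :
  0 < Lambda -> 0 < delta -> (0 < L)%N ->
  admissible (L%:R * (Lambda + 1) * delta) Lambda delta u ->
  exists a, sawtooth Lambda delta (L%:R * (Lambda + 1) * delta) L u a.
Proof.
move=> La0 d0 L0 [cu uT pu du [al [dis al_du]]].
exact: (sawtooth_exists La0 d0 cu pu du dis al_du L0).
Qed.

(** * The optimal profile *)

Lemma periodic_int (R : realType) (u : R -> R) (P : R) (n : int) x :
  (forall x, u (x + P) = u x) -> u (x + n%:~R * P) = u x.
Proof.
move=> uP; have nat_per k y : u (y + k%:R * P) = u y.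
  elim: k y => [|k IH] y; first by rewrite mul0r addr0.
  by rewrite -natr1 mulrDl mul1r addrA uP IH.
case: n => n; first exact: nat_per.
by rewrite NegzE mulrNz mulNr -[in RHS](subrK (n.+1%:R * P) x) nat_per.
Qed.

Lemma continuous_glue (R : realType) (f : R -> R) (x e p q : R) : 0 < e ->
  (forall y, x <= y <= x + e -> f y = f x + p * (y - x)) ->
  (forall y, x - e <= y <= x -> f y = f x + q * (y - x)) ->
  {for x, continuous f}.
Proof.
move=> e0 fp fq.
(* Half-sum and half-difference of the slopes merge both branches into one formula in y - x and |y -
   x|. *)
pose g y := f x + ((p + q) / 2 * (y - x) + (p - q) / 2 * `|y - x|).
have gx : g x = f x by rewrite /g subrr normr0 !mulr0 !addr0.
have cg : g y @[y --> x] --> g x.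
  apply: cvgD; first exact: cvg_cst.
  have cx : (y - x) @[y --> x] --> x - x by apply: cvgB; [exact: cvg_id|exact: cvg_cst].
  by apply: cvgD; apply: cvgMr => //; apply: cvg_norm.
rewrite /prop_for /continuous_at -gx; apply: cvg_trans cg; apply: near_eq_cvg.
near=> y.
have : `|x - y| < e by near: y; exact: (nbhsx_ballx x e e0).
rewrite ltr_norml /g => /andP[h1 h2].
have [xy|/ltW yx] := leP x y.
  have -> : f y = f x + p * (y - x) by apply: fp; apply/andP; split; lra.
  by rewrite ger0_norm ?subr_ge0//; lra.
have -> : f y = f x + q * (y - x) by apply: fq; apply/andP; split; lra.
by rewrite ler0_norm ?subr_le0//; lra.
Unshelve. all: by end_near. Qed.

(** Enumerates the integers, because [admissible] lists the descending intervals by natural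
    numbers. *)
Definition nat_to_int (k : nat) : int := if odd k then Negz k./2 else Posz k./2.

Lemma nat_to_int_inj : injective nat_to_int.
Proof.
move=> i j; rewrite /nat_to_int.
case Ei: (odd i); case Ej: (odd j) => // -[E];
by rewrite -(odd_double_half i) -(odd_double_half j) Ei Ej E.
Qed.

Lemma nat_to_int_surj n : exists k, nat_to_int k = n.
Proof.
case: n => n; rewrite /nat_to_int.
  by exists n.*2; rewrite odd_double doubleK.
by exists n.*2.+1; rewrite /= odd_double uphalf_double.
Qed.

Section Profile.
Context {R : realType}.
Local Notation mu := (@lebesgue_measure R).
Variables (Lambda delta : R).
Hypothesis Lambda0 : 0 < Lambda.
Hypothesis delta0 : 0 < delta.
Let P := (Lambda + 1) * delta.

(** The graph of [ubar] with its corner at the origin moved to (c, y), given on closed segments so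
    that neither rounding nor half-open cells appear. *)
Definition sawtooth_profile (c y : R) (w : R -> R) := forall n : int,
  (forall x, c + n%:~R * P - delta <= x <= c + n%:~R * P ->
     w x = y + - Lambda * (x - (c + n%:~R * P))) /\
  (forall x, c + n%:~R * P <= x <= c + n%:~R * P + Lambda * delta ->
     w x = y + 1 * (x - (c + n%:~R * P))).

Let PE : P = Lambda * delta + delta. Proof. by rewrite /P; ring. Qed.

Let P0 : 0 < P. Proof. by rewrite /P mulr_gt0// addr_gt0. Qed.

Lemma profile_cover (c x : R) : exists n : int,
  c + n%:~R * P - delta <= x < c + n%:~R * P + Lambda * delta.
Proof.
exists (Num.floor ((x - c + delta) / P)).
have /andP[] := floor_itv ((x - c + delta) / P).
move: (Num.floor _) => n.
rewrite ler_pdivlMr// ltr_pdivrMr// intrD mulrDl mul1r => h1 h2.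
have := PE => Pe; apply/andP; split; lra.
Qed.

Lemma profile_unique c y w1 w2 : sawtooth_profile c y w1 -> sawtooth_profile c y w2 ->
  w1 =1 w2.
Proof.
move=> w1P w2P x; have [n /andP[x1 x2]] := profile_cover c x.
have [w1n w1p] := w1P n; have [w2n w2p] := w2P n.
have [xn|/ltW nx] := leP x (c + n%:~R * P).
  by rewrite w1n ?w2n// x1 xn.
by rewrite w1p ?w2p// nx ltW.
Qed.

Lemma ubar_profile x0 y0 : sawtooth_profile x0 y0 (fun x => ubar Lambda delta (x - x0) + y0).
Proof.
move: Lambda0 delta0 => La0 d0.
have uE (n : int) x : n%:~R * P - delta < x <= n%:~R * P + Lambda * delta ->
    ubar Lambda delta x = if x - n%:~R * P < 0 then - Lambda * (x - n%:~R * P)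
                          else x - n%:~R * P.
  move=> /andP[x1 x2]; rewrite /ubar -/P.
  suff -> : Num.ceil ((x - Lambda * delta) / P) = n by [].
  apply/eqP; rewrite ceil_eq ltr_pdivlMr// ler_pdivrMr// intrB mulrBl mul1r.
  by have := PE => Pe; apply/andP; split; lra.
move=> n; split => x /andP[x1 x2].
  have [x3|x3] := ltP (n%:~R * P - delta) (x - x0).
    rewrite (uE n); last by have := mulr_gt0 La0 d0 => ?; apply/andP; split; lra.
    by case: ltP => h; [ring|have -> : x = x0 + n%:~R * P by lra]; ring.
  (* The left endpoint is a maximum and, the cell of [ubar] being open on the left, belongs to the
     preceding cell. *)
  have -> : x = x0 + n%:~R * P - delta by lra.
  have := mulr_gt0 La0 d0 => Ld.
  have E : x0 + n%:~R * P - delta - x0 - (n - 1)%:~R * P = Lambda * delta.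
    by rewrite intrB mulrBl mul1r PE; ring.
  rewrite (uE (n - 1)); last by apply/andP; split; lra.
  by rewrite E ltNge ltW//=; ring.
rewrite (uE n); last by apply/andP; split; lra.
by case: ltP => h; [lra|ring].
Qed.

(** With a single descending interval per period P, its right end is a minimum followed by an ascent
    of length Lambda delta; periodicity carries this to all integers [n]. *)
Lemma sawtooth_profileP (u : R -> R) (a : nat -> R) :
  sawtooth Lambda delta P 1 u a ->
  sawtooth_profile (a 0%N + delta) (u (a 0%N + delta)) u.
Proof.
move=> ua n; move: Lambda0 delta0 => La0 d0.
have a1 : a 1%N = a 0%N + P by rewrite -(saw_shift ua).
have Pe := PE.
have uE x : u x = u (x - n%:~R * P).
  by have := @periodic_int R u P (- n) x (saw_per ua); rewrite mulrNz mulNr => ->.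
split => x /andP[x1 x2]; rewrite uE.
  rewrite (saw_down ua (k := 0)); last by apply/andP; split; lra.
  rewrite (saw_down ua (k := 0) (x := _ + delta)); last by apply/andP; split; lra.
  by ring.
rewrite (saw_up ua (k := 0)); last by rewrite a1; apply/andP; split; lra.
by ring.
Qed.

Variables (c y0 : R) (w : R -> R).
Hypothesis wP : sawtooth_profile c y0 w.

Lemma profile_periodic x : w (x + P) = w x.
Proof.
have [n /andP[x1 x2]] := profile_cover c x.
have [wn wp] := wP n; have [wn1 wp1] := wP (n + 1).
rewrite intrD mulrDl mul1r in wn1 wp1.
have [xn|/ltW nx] := leP x (c + n%:~R * P).
  by rewrite (wn1 (x + P)) ?(wn x); [ring|apply/andP; split; lra..].
by rewrite (wp1 (x + P)) ?(wp x); [ring|apply/andP; split; lra..].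
Qed.

Lemma profile_continuous : continuous w.
Proof.
move: Lambda0 delta0 PE => La0 d0 Pe; have Ld := mulr_gt0 La0 d0.
have right x : exists e p, 0 < e /\ forall y, x <= y <= x + e -> w y = w x + p * (y - x).
  have [n /andP[x1 x2]] := profile_cover c x; have [wn wp] := wP n.
  have [nx|xn] := leP (c + n%:~R * P) x.
    exists (c + n%:~R * P + Lambda * delta - x), 1; split; first by lra.
    move=> y /andP[y1 y2].
    by rewrite !wp; [ring|apply/andP; split; lra..].
  exists (c + n%:~R * P - x), (- Lambda); split; first by lra.
  move=> y /andP[y1 y2].
  by rewrite !wn; [ring|apply/andP; split; lra..].
have left x : exists e p, 0 < e /\ forall y, x - e <= y <= x -> w y = w x + p * (y - x).
  have [n /andP[x1 x2]] := profile_cover c x; have [wn wp] := wP n.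
  have [nx|xn] := ltP (c + n%:~R * P) x.
    exists (x - (c + n%:~R * P)), 1; split; first by lra.
    move=> y /andP[y1 y2].
    by rewrite !wp; [ring|apply/andP; split; lra..].
  have [x3|x3] := ltP (c + n%:~R * P - delta) x.
    exists (x - (c + n%:~R * P - delta)), (- Lambda); split; first by lra.
    move=> y /andP[y1 y2].
    by rewrite !wn; [ring|apply/andP; split; lra..].
  have [wn1 wp1] := wP (n - 1); rewrite intrB mulrBl mul1r in wn1 wp1.
  exists (Lambda * delta), 1; split => // y /andP[y1 y2].
  by rewrite !wp1; [ring|apply/andP; split; lra..].
move=> x; have [e1 [p [e10 wp]]] := right x; have [e2 [q [e20 wq]]] := left x.
apply: (@continuous_glue R w x (Num.min e1 e2) p q).
- by rewrite lt_min e10.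
- move=> y /andP[xy]; rewrite -lerBlDl le_min => /andP[y1 y2].
  by apply: wp; apply/andP; split; lra.
- move=> y /andP[+ yx]; rewrite lerBlDl -lerBlDr le_min => /andP[y1 y2].
  by apply: wq; apply/andP; split; lra.
Qed.

Let B : set R := [set x | exists n : int, x = c + n%:~R * P \/ x = c + n%:~R * P - delta].

Let B_locally_finite a b : finite_set (B `&` [set` `[a, b]]).
Proof.
move: delta0 => d0.
(* [K] bounds |n| for every corner in [a, b]; shifting by [K] makes the indices natural numbers
   below 2K. *)
pose K := Num.bound ((`|a| + `|b| + `|c| + delta) / P).
pose f (k : nat) : R := c + (k%:Z - K%:Z)%:~R * P.
have KP : `|a| + `|b| + `|c| + delta < K%:R * P.
  rewrite -ltr_pdivrMr//; apply: archi_boundP; apply: divr_ge0; last exact: ltW.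
  by rewrite !addr_ge0// ltW.
apply: (@sub_finite_set _ _ ((f @` `I_(K + K)%N) `|` ((fun k => f k - delta) @` `I_(K + K)%N))).
  move=> x [[n xn]]; rewrite /= in_itv/= => /andP[ax xb].
  have nb : `|n%:~R * P| <= `|a| + `|b| + `|c| + delta.
    have := ler_norm a; have := ler_norm b; have := ler_norm c.
    have := ler_norm (- a); have := ler_norm (- b); have := ler_norm (- c).
    rewrite !normrN ler_norml => *; apply/andP.
    by case: xn => E; split; lra.
  have nK : `|n| < K%:Z.
    rewrite -(ltr_int R) -(ltr_pM2r P0); apply: le_lt_trans KP.
    by move: nb; rewrite normrM (gtr0_norm P0) intr_norm.
  have [k kE kK] : exists2 k : nat, k%:Z = n + K%:Z & (k < K + K)%N.
    by exists (absz (n + K%:Z)); lia.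
  have fk : f k = c + n%:~R * P by rewrite /f kE addrK.
  by case: xn => ->; [left|right]; exists k => //; rewrite fk.
by rewrite finite_setU; split; apply: finite_image; exact: finite_II.
Qed.

Let B_negligible : mu.-negligible B.
Proof.
have cB : countable B.
  have -> : B = (fun t : int * bool => c + t.1%:~R * P - (if t.2 then delta else 0)) @` setT.
    apply/seteqP; split=> x.
      move=> [n [->|->]]; [exists (n, false) => //=; exact: subr0|by exists (n, true)].
    by move=> [[n []] _ <-]; exists n; [right|left; rewrite subr0].
  exact: sub_countable (card_image_le _ _) (countableP _).
apply/negligibleP; last exact: countable_lebesgue_measure0.
exact: countable_measurable.
Qed.

Let off_B x : ~ B x -> exists n : int,
  (c + n%:~R * P - delta < x < c + n%:~R * P /\ is_derive x (1 : R) w (- Lambda)) \/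
  (c + n%:~R * P < x < c + n%:~R * P + Lambda * delta /\ is_derive x (1 : R) w 1).
Proof.
move=> nB; have [n /andP[x1 x2]] := profile_cover c x; exists n.
have [wn wp] := wP n.
have [xn|nx|xn] := ltgtP x (c + n%:~R * P).
- left; have x3 : c + n%:~R * P - delta < x.
    rewrite lt_neqAle x1 andbT; apply/eqP => xE; apply: nB; exists n; right.
    by rewrite -xE.
  rewrite x3; split => //.
  apply: (@is_derive_affine _ w (c + n%:~R * P - delta) (c + n%:~R * P)).
    by rewrite x3 xn.
  move=> y /andP[y1 y2]; move: delta0 => d0.
  by rewrite !wn; [ring|apply/andP; split; lra..].
- right; rewrite x2; split => //.
  apply: (@is_derive_affine _ w (c + n%:~R * P) (c + n%:~R * P + Lambda * delta)).
    by rewrite nx x2.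
  move=> y /andP[y1 y2]; have := mulr_gt0 Lambda0 delta0 => Ld.
  by rewrite !wp; [ring|apply/andP; split; lra..].
- by exfalso; apply: nB; exists n; left.
Qed.

Lemma profile_admissible (L : nat) : admissible (L%:R * (Lambda + 1) * delta) Lambda delta w.
Proof.
move: Lambda0 delta0 PE => La0 d0 Pe; have Ld := mulr_gt0 La0 d0.
split.
- exact: profile_continuous.
- move=> x; rewrite -mulrA; exact: (@periodic_int R w P L x profile_periodic).
- exists B; split; first exact: B_locally_finite.
  move=> x /off_B[n xn]; have [wn wp] := wP n.
  case: xn => -[/andP[x1 x2] _].
    exists (Num.min (x - (c + n%:~R * P - delta)) (c + n%:~R * P - x)).
      by rewrite lt_min; apply/andP; split; lra.
    exists (- Lambda), (y0 + Lambda * (c + n%:~R * P)) => y.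
    rewrite lt_min !ltr_norml => /andP[/andP[y1 y2] /andP[y3 y4]].
    by rewrite wn; [ring|apply/andP; split; lra].
  exists (Num.min (x - (c + n%:~R * P)) (c + n%:~R * P + Lambda * delta - x)).
    by rewrite lt_min; apply/andP; split; lra.
  exists 1, (y0 - (c + n%:~R * P)) => y.
  rewrite lt_min !ltr_norml => /andP[/andP[y1 y2] /andP[y3 y4]].
  by rewrite wp; [ring|apply/andP; split; lra].
- apply: negligibleS B_negligible => x /=; apply: contra_notP => /off_B[n].
  by move=> [[_ ?]|[_ ?]]; [right|left].
exists (fun k => c + (nat_to_int k)%:~R * P - delta); split.
  (* As P exceeds [delta] the intervals are disjoint, so the condition on common points holds
     vacuously. *)
  have sep i j : (nat_to_int i < nat_to_int j)%R ->
      c + (nat_to_int i)%:~R * P < c + (nat_to_int j)%:~R * P - delta.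
    rewrite -lezD1 -(ler_int R) intrD -(ler_pM2r P0) mulrDl mul1r; lra.
  move=> i j ij x y; rewrite !in_itv/= !subrK => /andP[h1 h2] /andP[h3 h4] _ _.
  have [ltij|ltji|/nat_to_int_inj//] := ltgtP (nat_to_int i) (nat_to_int j).
    have := sep _ _ ltij; lra.
  have := sep _ _ ltji; lra.
apply: negligibleS B_negligible => x /=; apply: contra_notP => /off_B[n].
move=> [[/andP[x1 x2] dx]|[/andP[x1 x2] dx]].
  split=> // _; have [k kn] := nat_to_int_surj n; exists k.
  by rewrite in_itv/= kn subrK; apply/andP; split; lra.
split.
  move=> dx'; have := @derive_val _ _ _ _ _ _ _ dx; rewrite (@derive_val _ _ _ _ _ _ _ dx').
  lra.
move=> [k]; rewrite in_itv/= subrK => /andP[k1 k2].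
have [kn|nk] := leP (nat_to_int k) n.
  have : (nat_to_int k)%:~R * P <= n%:~R * P by rewrite ler_pM2r// ler_int.
  lra.
have : (n + 1)%:~R * P <= (nat_to_int k)%:~R * P by rewrite ler_pM2r// ler_int lezD1.
rewrite intrD mulrDl mul1r; lra.
Qed.

End Profile.

(** * The seminorm as an average over displacements *)

Section Integrals.
Context {R : realType}.
Local Notation mu := (@lebesgue_measure R).

Lemma lebesgue_measure_translate (c : R) (A : set R) : measurable A ->
  pushforward mu (+%R c : _ -> measurableTypeR R) A = mu A.
Proof.
move=> mA; apply/esym/lebesgue_measure_unique => //=.
  by apply: measurable_funD => //; exact: measurable_cst.
move=> mf _ [[a b]] _ <-; rewrite /pushforward.
have -> : (+%R c) @^-1` `]a, b]%classic = `]a - c, b - c]%classic.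
  by apply/seteqP; split => x /=; rewrite !in_itv/= ltrBlDl lerBrDl.
rewrite !lebesgue_measure_itv/= !lte_fin ltrD2r; case: ifP => // _.
by rewrite -!EFinB; congr (_%:E); ring.
Qed.

Lemma ge0_integral_translate (c : R) (f : R -> \bar R) :
  measurable_fun [set: R] f -> (forall x, 0 <= f x)%E ->
  (\int[mu]_y f y = \int[mu]_y f (c + y)%R)%E.
Proof.
move=> mf f0.
transitivity (\int[pushforward mu (+%R c : _ -> measurableTypeR R)]_y f y)%E.
  apply: eq_measure_integral => //=.
    by apply: measurable_funD => //; exact: measurable_cst.
  by move=> ? A mA _; exact/esym/lebesgue_measure_translate.
rewrite ge0_integral_pushforward//=.
by apply: measurable_funD => //; exact: measurable_cst.
Qed.

Lemma integral_derive (f g : R -> R) (a b : R) : a < b ->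
  (forall x, is_derive x (1 : R) f (g x)) -> {within `[a, b], continuous g} ->
  (\int[mu]_(x in `[a, b]) (g x)%:E = (f b - f a)%:E)%E.
Proof.
move=> ab df cg; rewrite (@continuous_FTC2 R g f a b)//.
  have cf := is_derive_continuous df.
  split; first by move=> x _; have [] := df x.
    by apply: cvg_at_right_filter; exact: cf.
  by apply: cvg_at_left_filter; exact: cf.
by move=> x _; rewrite derive1E; have [] := df x.
Qed.

Variables (s T : R) (u S : R -> R).
Hypothesis cu : continuous u.
Hypothesis SE : forall h,
  (\int[mu]_(x in `[0%R, T]) ((u (x + h)%R - u x) ^+ 2)%:E = (S h)%:E)%E.

Lemma seminorm_energy :
  F T s u = (((2 * T)^-1)%:E * \int[mu]_h (S h / `|h| `^ (1 + 2 * s))%:E)%E.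
Proof.
rewrite /F; congr (_ * _)%E.
pose w (h : R) : R := `|h| `^ (- (1 + 2 * s)).
have wE h : w h = (`|h| `^ (1 + 2 * s))^-1 by rewrite /w powRN.
have w0 h : 0 <= w h by exact: powR_ge0.
have mu_ : measurable_fun [set: R] u by exact: continuous_measurable_fun.
have mw : measurable_fun [set: R] w.
  apply: (measurableT_comp (measurable_powR _)).
  exact: normr_measurable.
pose D : set R := `[0%R, T]%classic.
have mD : measurable D by exact: measurable_itv.
(* Substituting y = x + h and moving the domain of [x] into an indicator gives a nonnegative
   function on the plane, to which Tonelli applies. *)
pose f (z : R * R) : \bar R := (((u (z.1 + z.2) - u z.1) ^+ 2 * w z.2) * \1_D z.1)%:E.
have f0 z : (0 <= f z)%E.
  by rewrite lee_fin mulr_ge0// mulr_ge0// sqr_ge0.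
have mf : measurable_fun [set: (measurableTypeR R * measurableTypeR R)%type] f.
  apply/measurable_EFinP; apply: measurable_funM; last first.
    by apply: (measurableT_comp (measurable_indic _)) => //; exact: measurable_fst.
  apply: measurable_funM; last exact: (measurableT_comp mw measurable_snd).
  apply: measurable_funX; apply: measurable_funB.
    apply: (measurableT_comp mu_).
    by apply: measurable_funD; [exact: measurable_fst|exact: measurable_snd].
  exact: (measurableT_comp mu_ measurable_fst).
transitivity (\int[mu]_x \int[mu]_h f (x, h))%E.
  rewrite integral_mkcond; apply: eq_integral => x _; rewrite patchE.
  case: ifPn => xD; last first.
    rewrite (eq_integral (cst 0%E)); first by rewrite integral0.
    by move=> h _; rewrite /f/= indicE (negbTE xD) mulr0.
  rewrite [LHS](ge0_integral_translate x).
  - apply: eq_integral => h _; rewrite /f/= indicE xD mulr1 wE.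
    by rewrite -[in RHS]sqrrN opprB opprD addrA subrr sub0r normrN.
  - apply/measurable_EFinP; under eq_fun do rewrite -powRN.
    apply: measurable_funM.
      by apply: measurable_funX; apply: measurable_funB => //; exact: measurable_cst.
    apply: (measurableT_comp mw).
    by apply: measurable_funB => //; exact: measurable_cst.
  - by move=> y; rewrite lee_fin mulr_ge0 ?sqr_ge0// invr_ge0 powR_ge0.
rewrite (@fubini_tonelli _ _ _ _ _ mu mu f mf f0); apply: eq_integral => h _.
transitivity (\int[mu]_(x in D) ((w h)%:E * ((u (x + h)%R - u x) ^+ 2)%:E))%E.
  rewrite [RHS]integral_mkcond; apply: eq_integral => x _.
  rewrite /f/= patchE indicE; case: ifPn => _; last by rewrite mulr0.
  by rewrite mulr1 mulrC.
rewrite ge0_integralZl//; last first.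
- by rewrite lee_fin.
- by move=> x _; rewrite lee_fin sqr_ge0.
- apply/measurable_EFinP; apply: measurable_funTS.
  apply: measurable_funX; apply: measurable_funB => //.
  apply: (measurableT_comp mu_).
  by apply: measurable_funD => //; exact: measurable_cst.
by rewrite SE wE -EFinM mulrC.
Qed.

End Integrals.

(** * Finiteness of the weighted energy *)

Section Finiteness.
Context {R : realType}.
Local Notation mu := (@lebesgue_measure R).

Lemma integral_powR (p a b : R) : p != 0 -> 0 < a -> a < b ->
  (\int[mu]_(x in `[a, b]) (x `^ (p - 1))%:E = ((b `^ p - a `^ p) / p)%:E)%E.
Proof.
move=> p0 a0 ab.
have dP (x : R) : 0 < x -> is_derive x (1 : R) (fun y => p^-1 * y `^ p) (x `^ (p - 1)).
  move=> x0; have := is_deriveZ p^-1 (is_derive1_powR p x0).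
  by move=> /is_derive_eq; apply; rewrite /GRing.scale/= mulKf.
have cP (f g : R -> R) : (forall x : R, 0 < x -> is_derive x (1 : R) f (g x)) ->
    {within `[a, b], continuous f}.
  move=> df; apply: derivable_within_continuous => x; rewrite in_itv/= => /andP[ax _].
  by have [] := df x (lt_le_trans a0 ax).
rewrite (@continuous_FTC2 R _ (fun y => p^-1 * y `^ p) a b)//.
- by rewrite -EFinB; congr (_%:E); ring.
- apply: (cP _ (fun x => (p - 1) * x `^ (p - 1 - 1))).
- have cont (x : R) : 0 < x -> {for x, continuous (fun y => p^-1 * y `^ p)}.
    move=> x0; apply: differentiable_continuous; apply/derivable1_diffP.
    by have [] := dP x x0.
  split; first by move=> x; rewrite in_itv/= => /andP[ax _]; have [] := dP x (lt_trans a0 ax).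
    by apply: cvg_at_right_filter; exact: cont.
  by apply: cvg_at_left_filter; apply: cont; exact: lt_trans ab.
- move=> x; rewrite in_itv/= => /andP[ax _]; rewrite derive1E.
  by have [] := dP x (lt_trans a0 ax).
Qed.

Variables (S : R -> R) (C s : R).
Hypothesis s0 : 0 < s.
Hypothesis s1 : s < 1.
Hypothesis cS : continuous S.
Hypothesis S_even : forall h, S (- h) = S h.
Hypothesis S_ge0 : forall h, 0 <= S h.
Hypothesis S_le : forall h, S h <= C.
Hypothesis S_le2 : forall h, S h <= C * h ^+ 2.

Let G (h : R) : \bar R := (S h / `|h| `^ (1 + 2 * s))%:E.

Lemma measurable_weighted : measurable_fun [set: R] G.
Proof.
apply/measurable_EFinP; under eq_fun do rewrite -powRN.
apply: measurable_funM; first exact: continuous_measurable_fun.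
by apply: (measurableT_comp (measurable_powR _)); exact: normr_measurable.
Qed.

Let G0 h : (0 <= G h)%E.
Proof. by rewrite lee_fin mulr_ge0// invr_ge0 powR_ge0. Qed.

(** The quadratic bound [S_le2] leaves the power h^(1 - 2s), integrable at 0 because s < 1; the
    estimate is uniform in [a]. *)
Let G_near0 a : 0 < a -> a < 1 ->
  (\int[mu]_(h in `[a, 1%R]) G h <= (C / (2 - 2 * s))%:E)%E.
Proof.
move=> a0 a1; have C0 : 0 <= C := le_trans (S_ge0 0) (S_le 0).
move: s1 => s1'; have q0 : 0 < 2 - 2 * s by lra.
apply: (@le_trans _ _ (\int[mu]_(h in `[a, 1%R]) (C * h `^ (2 - 2 * s - 1))%:E)%E).
  apply: ge0_le_integral => //.
  - by apply: measurable_funTS; exact: measurable_weighted.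
  - apply: measurable_funTS; apply/measurable_EFinP; exact: measurable_funM.
  move=> h /=; rewrite in_itv/= => /andP[ah _]; have h0 := lt_le_trans a0 ah.
  rewrite /G lee_fin gtr0_norm// ler_pdivrMr ?powR_gt0// -mulrA -powRD.
    have -> : 2 - 2 * s - 1 + (1 + 2 * s) = 2%:R by ring.
    by rewrite powR_mulrn ?S_le2// ltW.
  by apply/implyP => _; rewrite gt_eqF.
under eq_integral do rewrite EFinM.
rewrite ge0_integralZl//.
- rewrite integral_powR ?gt_eqF// -EFinM lee_fin powR1 ler_wpM2l//.
  by rewrite -[leRHS]mul1r ler_pM2r ?invr_gt0// gerBl powR_ge0.
- by apply: measurable_funTS; apply/measurable_EFinP; exact: measurable_powR.
- by move=> h _; rewrite lee_fin powR_ge0.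
Qed.

(** The uniform bound [S_le] leaves the power h^(-1 - 2s), integrable at infinity because s > 0. *)
Let G_far b : 1 < b -> (\int[mu]_(h in `[1%R, b]) G h <= (C / (2 * s))%:E)%E.
Proof.
move=> b1; have C0 : 0 <= C := le_trans (S_ge0 0) (S_le 0).
move: s0 => s0'; have q0 : - (2 * s) < 0 by lra.
apply: (@le_trans _ _ (\int[mu]_(h in `[1%R, b]) (C * h `^ (- (2 * s) - 1))%:E)%E).
  apply: ge0_le_integral => //.
  - by apply: measurable_funTS; exact: measurable_weighted.
  - apply: measurable_funTS; apply/measurable_EFinP; exact: measurable_funM.
  move=> h /=; rewrite in_itv/= => /andP[ah _]; have h0 := lt_le_trans ltr01 ah.
  rewrite /G lee_fin gtr0_norm// ler_pdivrMr ?powR_gt0// -mulrA -powRD.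
    have -> : - (2 * s) - 1 + (1 + 2 * s) = 0 by ring.
    by rewrite powRr0 mulr1.
  by apply/implyP => _; rewrite gt_eqF.
under eq_integral do rewrite EFinM.
rewrite ge0_integralZl//.
- rewrite integral_powR ?lt_eqF// -EFinM lee_fin powR1 ler_wpM2l//.
  rewrite invrN mulrN -mulNr opprB -[leRHS]mul1r ler_pM2r ?invr_gt0; last by lra.
  by rewrite gerBl powR_ge0.
- by apply: measurable_funTS; apply/measurable_EFinP; exact: measurable_powR.
- by move=> h _; rewrite lee_fin powR_ge0.
Qed.

Let G_pos : (\int[mu]_(h in `]0%R, +oo[) G h <= (C / (2 - 2 * s) + C / (2 * s))%:E)%E.
Proof.
(* Compact exhaustion of the half-line; starting at 2 keeps the splitting point 1 strictly
   inside. *)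
pose A n : set R := `[n.+2%:R^-1, n.+2%:R]%classic.
have UA : `]0%R, +oo[%classic = \bigcup_n A n.
  apply/seteqP; split => x /=; rewrite in_itv/= andbT.
    move=> x0; pose n := maxn (Num.bound x) (Num.bound x^-1).
    exists n => //; rewrite /A/= in_itv/=.
    have xn : x < n.+2%:R.
      apply: (lt_trans (archi_boundP (ltW x0))); rewrite ltr_nat /n.
      by have := leq_maxl (Num.bound x) (Num.bound x^-1); lia.
    have x1 : 0 <= x^-1 by rewrite invr_ge0 ltW.
    have xn' : x^-1 < n.+2%:R.
      apply: (lt_trans (archi_boundP x1)); rewrite ltr_nat /n.
      by have := leq_maxr (Num.bound x) (Num.bound x^-1); lia.
    by rewrite (ltW xn) andbT -[leRHS]invrK lef_pV2 ?posrE ?invr_gt0// ltW.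
  move=> [n _]; rewrite /A/= in_itv/= => /andP[nx _].
  by apply: lt_le_trans nx; rewrite invr_gt0.
have ndA : nondecreasing_seq A.
  move=> m n mn; rewrite subsetEset; apply: subset_itvScc.
    by rewrite bnd_simp lef_pV2 ?posrE// ler_nat.
  by rewrite bnd_simp ler_nat.
have mG D : measurable_fun D G by apply: measurable_funTS; exact: measurable_weighted.
have cA : (\int[mu]_(x in A i) G x @[i --> \oo] --> \int[mu]_(x in \bigcup_i A i) G x)%E.
  apply: ge0_nondecreasing_set_cvg_integral => //.
  - by move=> i; exact: measurable_itv.
  - by move=> i; exact: mG.
rewrite -UA in cA; rewrite -(cvg_lim _ cA)//; apply: lime_le.
  by apply/cvg_ex; eexists; exact: cA.
near=> n; rewrite /A.
have n1 : n.+2%:R^-1 < 1 :> R by rewrite invf_lt1 ?ltr1n.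
have n2 : 1 < n.+2%:R :> R by rewrite ltr1n.
have -> : `[n.+2%:R^-1, n.+2%:R]%classic =
    `[n.+2%:R^-1, 1%R[%classic `|` `[1%R, n.+2%:R]%classic :> set R.
  apply/seteqP; split=> x /=; rewrite !in_itv/=.
    move=> /andP[h1 h2]; case: (ltP x 1) => h; [left|right]; apply/andP; split => //.
  case=> /andP[h1 h2]; apply/andP; split => //.
    exact/ltW/(lt_trans h2).
  exact: le_trans (ltW n1) h1.
rewrite ge0_integral_setU//; last 2 first.
- exact: mG.
- apply/disj_setPLR => x /=; rewrite !in_itv/= => /andP[_ h]; apply/negP.
  by rewrite negb_and -ltNge h.
rewrite EFinD leeD//; last exact: G_far.
by rewrite integral_itv_bndo_bndc//; apply: G_near0 => //; rewrite invr_gt0.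
Unshelve. all: by end_near. Qed.

Lemma weighted_energy_fin : (\int[mu]_h G h < +oo)%E.
Proof.
have mG D : measurable_fun D G by apply: measurable_funTS; exact: measurable_weighted.
have E : (\int[mu]_(h in `]-oo, 0%R]) G h = \int[mu]_(h in `]0%R, +oo[) G h)%E.
  rewrite [RHS]integral_itv_obnd_cbnd; last exact: mG.
  rewrite ge0_integration_by_substitution0; [|exact: measurable_weighted|exact: G0].
  by apply: eq_integral => h _; rewrite /G S_even normrN.
have -> : [set: R] = `]-oo, 0%R]%classic `|` `]0%R, +oo[%classic.
  apply/seteqP; split=> // x _ /=; rewrite !in_itv/= andbT.
  by case: (ltP 0 x) => h; [right|left].
rewrite ge0_integral_setU//; last 2 first.
- exact: mG.
- apply/disj_setPLR => x /=; rewrite !in_itv/= => h; apply/negP.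
  by rewrite andbT -leNgt.
rewrite E; apply: le_lt_trans (leeD G_pos G_pos) _.
by rewrite -EFinD ltry.
Qed.

End Finiteness.

(** * Minimizers *)

Section EnergyFunction.
Context {R : realType}.
Local Notation mu := (@lebesgue_measure R).
Implicit Types (u v : R -> R) (a b : nat -> R).

(** [fine] loses nothing for continuous [u] and positive [T], see [integral_energy]. *)
Definition energy (T : R) u (h : R) : R :=
  fine (\int[mu]_(x in `[0%R, T]) ((u (x + h)%R - u x) ^+ 2)%:E)%E.

Lemma increment_sqr_continuous u h : continuous u ->
  continuous (fun x => (u (x + h) - u x) ^+ 2).
Proof.
move=> cu x; have cd : (u (y + h) - u y) @[y --> x] --> u (x + h) - u x.
  by apply: cvgB; [exact: continuous_translate|exact: cu].
by apply: cvgM.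
Qed.

Lemma increment_antiderivative u h : continuous u ->
  exists Z, forall x, is_derive x (1 : R) Z ((u (x + h) - u x) ^+ 2).
Proof. by move=> cu; apply: antiderivative; exact: increment_sqr_continuous. Qed.

Lemma integral_increment T u h (Z : R -> R) : 0 < T -> continuous u ->
  (forall x, is_derive x (1 : R) Z ((u (x + h) - u x) ^+ 2)) ->
  (\int[mu]_(x in `[0%R, T]) ((u (x + h)%R - u x) ^+ 2)%:E = (Z T - Z 0)%:E)%E.
Proof.
move=> T0 cu dZ; apply: integral_derive => //.
by apply: continuous_subspaceT; exact: increment_sqr_continuous.
Qed.

Lemma energy_antiderivative T u h (Z : R -> R) : 0 < T -> continuous u ->
  (forall x, is_derive x (1 : R) Z ((u (x + h) - u x) ^+ 2)) ->
  energy T u h = Z T - Z 0.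
Proof. by move=> T0 cu dZ; rewrite /energy (integral_increment T0 cu dZ). Qed.

Lemma integral_energy T u h : 0 < T -> continuous u ->
  (\int[mu]_(x in `[0%R, T]) ((u (x + h)%R - u x) ^+ 2)%:E = (energy T u h)%:E)%E.
Proof.
move=> T0 cu; have [Z dZ] := increment_antiderivative h cu.
by rewrite (energy_antiderivative T0 cu dZ); exact: integral_increment.
Qed.

Lemma energy_ge0 T u h : 0 <= energy T u h.
Proof.
by apply: fine_ge0; apply: integral_ge0 => x _; rewrite lee_fin sqr_ge0.
Qed.

Lemma energy_bound T u h K : 0 < T -> continuous u ->
  (forall x, `|u (x + h) - u x| <= K) -> energy T u h <= T * K ^+ 2.
Proof.
move=> T0 cu uK; have [Z dZ] := increment_antiderivative h cu.
rewrite (energy_antiderivative T0 cu dZ).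
have cZ : {within `[0, T], continuous Z}.
  exact: continuous_subspaceT (is_derive_continuous dZ).
have [c _ ->] := MVT_segment (ltW T0) (fun x _ => dZ x) cZ.
rewrite subr0 mulrC ler_pM2l// -[leLHS]real_normK ?num_real//.
by rewrite lerXn2r// nnegrE// (le_trans _ (uK c)).
Qed.

(** A primitive [Z] of the squared increment is nondecreasing, and zero energy makes it periodic;
    hence it is constant and its derivative vanishes everywhere. *)
Lemma energy_eq0_periodic T u h : 0 < T -> continuous u -> (forall x, u (x + T) = u x) ->
  energy T u h = 0 -> forall x, u (x + h) = u x.
Proof.
move=> T0 cu uT E0 x; have [Z dZ] := increment_antiderivative h cu.
move: E0; rewrite (energy_antiderivative T0 cu dZ) => ZT.
have ZP y : Z (y + T) = Z y.
  by rewrite (derive_periodic dZ) ?ZT ?addr0// => z; rewrite (addrAC z) !uT.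
have Zmono y z : y <= z -> Z y <= Z z.
  move=> yz; have cZ : {within `[y, z], continuous Z}.
    exact: continuous_subspaceT (is_derive_continuous dZ).
  have [c _ E] := MVT_segment yz (fun x _ => dZ x) cZ.
  by rewrite -subr_ge0 E mulr_ge0 ?sqr_ge0// subr_ge0.
have d0 : is_derive x (1 : R) Z 0.
  apply: (@is_derive_affine _ Z (x - T / 2) (x + T / 2)); first by apply/andP; split; lra.
  move=> y /andP[y1 y2]; rewrite mul0r addr0; apply/eqP; rewrite eq_le (Zmono _ _ y1) andbT.
  rewrite -[leRHS]ZP; apply: Zmono; lra.
have := @derive_val _ _ _ _ _ _ _ (dZ x); rewrite (@derive_val _ _ _ _ _ _ _ d0).
by move=> /esym/eqP; rewrite sqrf_eq0 subr_eq0 => /eqP.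
Qed.

Variables (Lambda delta : R).
Hypothesis Lambda0 : 0 < Lambda.
Hypothesis delta0 : 0 < delta.

Section SawtoothEnergy.
Variables (T : R) (L : nat) (u : R -> R) (a : nat -> R).
Hypothesis T0 : 0 < T.
Hypothesis ua : sawtooth Lambda delta T L u a.

(** A single [W] serves all displacements, so evenness and continuity in [h] can be read off from
    [diff2 W h]. *)
Let energyW : exists2 W : R -> R, continuous W & forall h, energy T u h =
  - (Lambda + 1) * \sum_(k < L) (diff2 W h (a (0 + k)%N + delta) - diff2 W h (a (0 + k)%N)).
Proof.
have [U dU] := antiderivative (saw_cont ua).
have [W dW] := antiderivative (is_derive_continuous dU).
exists W; first exact: is_derive_continuous dW.
move=> h; have [Z dZ] := increment_antiderivative h (saw_cont ua).
rewrite (energy_antiderivative T0 (saw_cont ua) dZ) -(saw_energy delta0 ua dU dW dZ 0).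
rewrite (derive_periodic dZ); first by ring.
by move=> y; rewrite (addrAC y) !(saw_per ua).
Qed.

Lemma saw_energy_even h : energy T u (- h) = energy T u h.
Proof.
have [W _ WE] := energyW; rewrite !WE; congr (_ * _); apply: eq_bigr => k _.
by rewrite /diff2 !opprK; ring.
Qed.

Lemma saw_energy_continuous : continuous (energy T u).
Proof.
have [W cW WE] := energyW.
rewrite (funext WE) => h; apply: cvgMr; apply: cvg_big => [|k _]; first exact: add_continuous.
have c x : {for h, continuous (fun h => diff2 W h x)}.
  apply: cvgB; last exact: cvg_cst.
  by apply: cvgD; apply: (@continuous_comp _ _ _ (fun h => _) W); try exact: cW;
    apply: cvgD; try exact: cvg_cst; [exact: cvg_id|apply: cvgN; exact: cvg_id].
by apply: cvgB; exact: c.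
Qed.

End SawtoothEnergy.

Lemma sawtooth_multiple (T : R) (L : nat) u a : sawtooth Lambda delta T 1 u a ->
  sawtooth Lambda delta (L%:R * T) L u a.
Proof.
move=> ua; split.
- exact: saw_cont ua.
- move=> x; exact: (@periodic_int _ u T L x (saw_per ua)).
- exact: saw_gap ua.
- move=> k; elim: L => [|L IH]; first by rewrite addn0 mul0r addr0.
  by rewrite addnS -addn1 (saw_shift ua) IH -natr1; ring.
- exact: saw_down ua.
- exact: saw_up ua.
Qed.

Lemma energy_minimal (T P : R) (L : nat) u v a b : 0 < T -> delta <= P -> T = L%:R * P ->
  sawtooth Lambda delta T L u a -> sawtooth Lambda delta T L v b ->
  (forall k, b k.+1 = b k + P) -> forall h, energy T v h <= energy T u h.
Proof.
move=> T0 dP TE ua vb bP.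
have nonneg h : 0 <= h -> energy T v h <= energy T u h.
  move=> h0; have [Zu dZu] := increment_antiderivative h (saw_cont ua).
  have [Zv dZv] := increment_antiderivative h (saw_cont vb).
  rewrite (energy_antiderivative T0 (saw_cont ua) dZu).
  rewrite (energy_antiderivative T0 (saw_cont vb) dZv).
  exact: (energy_le Lambda0 delta0 dP TE ua vb bP h0 dZu dZv).
move=> h; have [h0|/ltW h0] := leP 0 h; first exact: nonneg.
by rewrite -(saw_energy_even T0 ua) -(saw_energy_even T0 vb) nonneg// oppr_ge0.
Qed.

Lemma admissible_increment (T : R) u h : admissible T Lambda delta u ->
  forall x, `|u (x + h) - u x| <= (Lambda + 1) * `|h|.
Proof.
move=> [cu _ pu du _]; move: Lambda0 => La0.
have pos y z : y <= z -> `|u z - u y| <= (Lambda + 1) * (z - y).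
  move=> yz; have := slope_le1 La0 cu pu du yz; have := slope_geN La0 cu pu du yz.
  by move=> h1 h2; rewrite ler_norml; apply/andP; split; nra.
move=> x; have [h0|/ltW h0] := leP 0 h.
  have xh : x <= x + h by rewrite lerDl.
  by have := pos _ _ xh; rewrite (ger0_norm h0) (_ : x + h - x = h)//; ring.
rewrite (ler0_norm h0) distrC; have -> : - h = x - (x + h) by ring.
by apply: pos; rewrite gerDl.
Qed.

Lemma admissible_increment_bounded (T : R) u h : 0 < T -> admissible T Lambda delta u ->
  forall x, `|u (x + h) - u x| <= (Lambda + 1) * T.
Proof.
move=> T0 ad x; have [_ uT _ _ _] := ad.
have /andP[] := floor_itv (h / T); move: (Num.floor _) => n.
rewrite ler_pdivlMr// ltr_pdivrMr// intrD mulrDl mul1r => n1 n2.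
have -> : u (x + h) = u (x + (h - n%:~R * T)).
  by rewrite addrA -mulNr -intrN periodic_int.
apply: le_trans (admissible_increment _ ad x) _; rewrite ler_wpM2l//.
  by move: Lambda0; lra.
by rewrite ger0_norm; lra.
Qed.

End EnergyFunction.

Section Minimizers.
Context {R : realType}.
Local Notation mu := (@lebesgue_measure R).
Variables (Lambda delta s : R) (L : nat).
Hypothesis Lambda0 : 0 < Lambda.
Hypothesis delta0 : 0 < delta.
Hypothesis L0 : (0 < L)%N.
Hypothesis s0 : 0 < s.
Hypothesis s1 : s < 1.
Let P := (Lambda + 1) * delta.
Let T := L%:R * (Lambda + 1) * delta.

Let TE : T = L%:R * P. Proof. by rewrite /T /P mulrA. Qed.
Let P0 : 0 < P. Proof. by rewrite /P mulr_gt0// addr_gt0. Qed.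
Let T0 : 0 < T. Proof. by rewrite TE mulr_gt0// ltr0n. Qed.
Let dP : delta <= P.
Proof. by rewrite /P mulrDl mul1r lerDr mulr_ge0// ltW. Qed.

(** Admissibility for the period P, that is with one interval per period, yields a listing that
    advances by P at each step. *)
Lemma profile_sawtooth c y w : sawtooth_profile Lambda delta c y w ->
  exists2 b, sawtooth Lambda delta T L w b & forall k, b k.+1 = b k + P.
Proof.
move=> wP; have := admissible_sawtooth Lambda0 delta0 (ltnSn 0)
  (profile_admissible Lambda0 delta0 wP 1).
rewrite mul1r => -[b wb]; exists b.
  by rewrite TE; exact: sawtooth_multiple.
by move=> k; rewrite -addn1 (saw_shift wb).
Qed.

Lemma profile_minimizer c y w : sawtooth_profile Lambda delta c y w ->
  is_minimizer T Lambda delta s w.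
Proof.
move=> wP; split; first exact: profile_admissible wP L.
move=> v adv; have [b wb bP] := profile_sawtooth wP.
have [a va] := admissible_sawtooth Lambda0 delta0 L0 adv.
rewrite (seminorm_energy s (saw_cont wb) (fun h => integral_energy h T0 (saw_cont wb))).
rewrite (seminorm_energy s (saw_cont va) (fun h => integral_energy h T0 (saw_cont va))).
apply: lee_wpmul2l; first by rewrite lee_fin invr_ge0 mulr_ge0// ltW.
apply: ge0_le_integral => //.
- by move=> h _; rewrite lee_fin divr_ge0 ?energy_ge0 ?powR_ge0.
- by apply: measurable_weighted; exact: saw_energy_continuous wb.
- by apply: measurable_weighted; exact: saw_energy_continuous va.
move=> h _; rewrite lee_fin ler_wpM2r ?invr_ge0 ?powR_ge0//.
exact: (energy_minimal Lambda0 delta0 T0 dP TE va wb bP).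
Qed.

Lemma minimizer_periodic u : is_minimizer T Lambda delta s u -> forall x, u (x + P) = u x.
Proof.
move=> [adu umin].
pose w x := ubar Lambda delta (x - 0) + 0.
have wP : sawtooth_profile Lambda delta 0 0 w := ubar_profile Lambda0 delta0 0 0.
have adw : admissible T Lambda delta w := profile_admissible Lambda0 delta0 wP L.
have [b wb bP] := profile_sawtooth wP.
have [a ua] := admissible_sawtooth Lambda0 delta0 L0 adu.
have cEu := saw_energy_continuous delta0 T0 ua.
have cEw := saw_energy_continuous delta0 T0 wb.
have Ele h : energy T w h <= energy T u h.
  exact: (energy_minimal Lambda0 delta0 T0 dP TE ua wb bP).
have EwP : energy T w P = 0.
  apply/eqP; rewrite eq_le energy_ge0 andbT.
  have := @energy_bound _ T w P 0 T0 (saw_cont wb); rewrite expr0n mulr0; apply => x.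
  by rewrite (profile_periodic Lambda0 delta0 wP) subrr normr0.
apply: (energy_eq0_periodic T0 (saw_cont ua) (saw_per ua)).
apply/eqP; rewrite eq_le energy_ge0 andbT leNgt; apply/negP => EuP.
pose G f (h : R) : \bar R := (f h / `|h| `^ (1 + 2 * s))%:E.
pose D h := energy T u h - energy T w h.
have cD : continuous D by move=> h; apply: cvgB; [exact: cEu|exact: cEw].
have G0 f h : 0 <= f h -> (0 <= G f h)%E.
  by move=> f0; rewrite lee_fin divr_ge0// powR_ge0.
have D0 h : 0 <= D h by rewrite subr_ge0.
have mD := measurable_weighted s cD.
have K0 : 0 <= Lambda + 1 by rewrite addr_ge0// ltW.
have finw : (\int[mu]_h G (energy T w) h < +oo)%E.
  (* The sum of the constants of a uniform and a quadratic bound, so that one constant serves both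
     hypotheses. *)
  pose C := T * ((Lambda + 1) * T) ^+ 2 + T * (Lambda + 1) ^+ 2.
  have C1 : 0 <= T * ((Lambda + 1) * T) ^+ 2 by rewrite mulr_ge0 ?sqr_ge0// ltW.
  have C2 : 0 <= T * (Lambda + 1) ^+ 2 by rewrite mulr_ge0 ?sqr_ge0// ltW.
  apply: (@weighted_energy_fin _ (energy T w) C s s0 s1 cEw).
  - exact: (saw_energy_even delta0 T0 wb).
  - exact: energy_ge0.
  - move=> h; apply: (le_trans (energy_bound T0 (saw_cont wb)
      (admissible_increment_bounded Lambda0 h T0 adw))).
    by rewrite lerDl.
  - move=> h; apply: (le_trans (energy_bound T0 (saw_cont wb)
      (admissible_increment Lambda0 h adw))).
    by rewrite exprMn real_normK ?num_real// mulrA ler_wpM2r ?sqr_ge0// lerDr.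
have Fle : (\int[mu]_h G (energy T u) h <= \int[mu]_h G (energy T w) h)%E.
  have := umin w adw.
  rewrite (seminorm_energy s (saw_cont wb) (fun h => integral_energy h T0 (saw_cont wb))).
  rewrite (seminorm_energy s (saw_cont ua) (fun h => integral_energy h T0 (saw_cont ua))).
  by rewrite lee_pmul2l// lte_fin invr_gt0 mulr_gt0.
have GD : (\int[mu]_h G (energy T u) h =
    \int[mu]_h G (energy T w) h + \int[mu]_h G D h)%E.
  rewrite -ge0_integralD//.
  - apply: eq_integral => h _; rewrite /G -EFinD -mulrDl.
    by congr (_ / _)%:E; rewrite /D; ring.
  - by move=> h _; apply: G0; exact: energy_ge0.
  - exact: measurable_weighted.
  - by move=> h _; apply: G0.
have GD0 : (\int[mu]_h `|G D h| = 0)%E.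
  under eq_integral do rewrite gee0_abs ?G0//.
  apply/eqP; rewrite eq_le integral_ge0 ?andbT; last by move=> h _; exact: G0.
  (* Finiteness of the minimal energy permits cancelling it, which leaves a nonpositive integral of
     the nonnegative [G D]. *)
  have fin : (\int[mu]_h G (energy T w) h)%E \is a fin_num.
    by rewrite ge0_fin_numE// integral_ge0// => h _; apply: G0; exact: energy_ge0.
  by move: Fle; rewrite GD -[leRHS]adde0 leeD2lE.
have /(ae_eq_integral_abs mu measurableT mD) aeD := GD0.
have DP : 0 < D P by rewrite /D EwP subr0.
(* By continuity [D] stays positive to the right of P, where almost every point satisfies
   [G D h = 0]. *)
have : \forall h \near P, 0 < D h by apply: cvgr_gt (cD P) _ DP.
move=> [e /= e0 He].
have /(ae_exists_oo aeD)[h /andP[h1 h2] /(_ I) /= GDh] : P < P + e by rewrite ltrDl.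
have Dh : 0 < D h.
  by apply: He; rewrite /= distrC gtr0_norm ?subr_gt0// ltrBlDl.
have h0 : 0 < h := lt_trans P0 h1.
move: GDh => /eqP; rewrite eqe gt_eqF// divr_gt0// powR_gt0// normr_gt0 gt_eqF//.
Qed.

End Minimizers.

Theorem theorem1p3 (R : realType) (Lambda delta s : R) (L : nat) :
  0 < Lambda -> 0 < delta -> (0 < L)%N -> 0 < s -> s < 1 ->
  forall u : R -> R,
    is_minimizer (L%:R * (Lambda + 1) * delta) Lambda delta s u <->
    exists x0 y0 : R, forall x, u x = ubar Lambda delta (x - x0) + y0.
Proof.
move=> La0 d0 L0 s0 s1 u; split.
  move=> umin; have uP := minimizer_periodic La0 d0 L0 s0 s1 umin.
  have [[cu _ pu du al] _] := umin.
  (* Being P-periodic, [u] is admissible also with [L] replaced by 1, so it has one descending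
     interval per period. *)
  have ad1 : admissible (1%:R * (Lambda + 1) * delta) Lambda delta u.
    by split => //; rewrite mul1r.
  have [a] := admissible_sawtooth La0 d0 (ltnSn 0) ad1.
  rewrite mul1r => /(sawtooth_profileP La0 d0) prof.
  exists (a 0%N + delta), (u (a 0%N + delta)).
  exact: profile_unique La0 d0 _ _ _ _ prof (ubar_profile La0 d0 _ _).
move=> [x0 [y0 uE]]; have -> : u = fun x => ubar Lambda delta (x - x0) + y0 by exact/funext.
exact: (profile_minimizer _ La0 d0 L0 (ubar_profile La0 d0 x0 y0)).
Qed.
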